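(* Let $\mathcal{C}$ be a rigid monoidal category acting linearly from the right on a finite abelian category $\mathcal{M}$ over a field $k$, let $\Sigma\in\mathrm{Rex}_{\mathcal{C}}(\mathcal{M},\mathcal{M}_{\mathbb{D}})$, and let $\mathbb{N}=\mathbb{N}_{\mathcal{M}}$ be the Nakayama functor. The three bijections $$\mathrm{Nat}(\Sigma,\mathbb{N})\xrightarrow{\Phi_1}\mathrm{Tr}(\Sigma)\xrightarrow{\Phi_2}\mathrm{Nat}(\mathbb{h}_\Sigma,\mathbb{h}^* )\xrightarrow{\Phi_3}\mathrm{Nat}(\Sigma,\mathbb{N})$$ defined in the context restrict to bijections between the following three sets: - the set of module-compatible $\Sigma$-twisted traces on $\mathrm{Proj}(\mathcal{M})$; - the set of module-compatible natural transformations $\Sigma\to\mathbb{N}$; - the set of module-compatible natural transformations $\mathbb{h}_\Sigma\to\mathbb{h}^*$.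
   Context: A finite abelian category is a $k$-linear category equivalent to the category of finite-dimensional left modules over a finite-dimensional $k$-algebra. $\mathcal{P}=\mathrm{Proj}(\mathcal{M})$ is the full subcategory of projective objects, $\mathbf{Vect}$ the category of finite-dimensional vector spaces. For $V\in\mathbf{Vect}$, $M\in\mathcal{M}$, $V\cdot M$ is defined by the natural isomorphism $\mathrm{Hom}_{\mathcal{M}}(V\cdot M,N)\cong\mathrm{Hom}_k(V,\mathrm{Hom}_{\mathcal{M}}(M,N))$; $k$-linear functors $F$ have canonical isomorphisms $V\cdot F(M)\cong F(V\cdot M)$, where defined (e.g. $V\otimes_k\mathrm{Hom}_{\mathcal{M}}(M,M')\cong\mathrm{Hom}_{\mathcal{M}}(M,V\cdot M')$). Nakayama functor: $\mathbb{N}(M)=\int^{X\in\mathcal{M}}\mathrm{Hom}_{\mathcal{M}}(M,X)^*\cdot X$ with universal dinatural transformation $\mathbb{i}_{X,M}$. $\mathrm{Tr}(\Sigma)$: the set of $\Sigma$-twisted traces on $\mathcal{P}$, i.e. families of linear maps $\mathtt{t}_P:\mathrm{Hom}_{\mathcal{M}}(P,\Sigma(P))\to k$ ($P\in\mathcal{P}$) with $\mathtt{t}_P(gf)=\mathtt{t}_Q(\Sigma(f)g)$ for all $f:P\to Q$, $g:Q\to\Sigma(P)$, $P,Q\in\mathcal{P}$. Canonical Nakayama-twisted trace $\widetilde{\mathtt{t}}_\bullet\in\mathrm{Tr}(\mathbb{N})$: $\widetilde{\mathtt{t}}_P$ is the unique linear map with $\widetilde{\mathtt{t}}_P(\mathbb{i}_{X,P}\circ\Lambda(\omega,f))=\omega(f)$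 for all $X$, $\omega\in\mathrm{Hom}_{\mathcal{M}}(P,X)^*$, $f\in\mathrm{Hom}_{\mathcal{M}}(P,X)$, where $\Lambda(\omega,f):P\to\mathrm{Hom}_{\mathcal{M}}(P,X)^*\cdot X$ corresponds to $\omega\otimes f$ under the canonical isomorphism. The map $\widetilde\alpha_{M,P}:\mathrm{Hom}_{\mathcal{M}}(M,\mathbb{N}(P))\to\mathrm{Hom}_{\mathcal{M}}(P,M)^*$, $\langle\widetilde\alpha_{M,P}(f),g\rangle=\widetilde{\mathtt{t}}_P(fg)$, is a natural isomorphism. Functors $\mathcal{M}^{\mathrm{op}}\times\mathcal{P}\to\mathbf{Vect}$: $\mathbb{h}^*(M,P)=\mathrm{Hom}_{\mathcal{M}}(P,M)^*$, $\mathbb{h}_\Sigma(M,P)=\mathrm{Hom}_{\mathcal{M}}(M,\Sigma(P))$. $\Phi_1(\xi)_P(f)=\widetilde{\mathtt{t}}_P(\xi_P\circ f)$. $\Phi_2(\mathtt{t}_\bullet)=\alpha$ with $\langle\alpha_{M,P}(f),g\rangle=\mathtt{t}_P(fg)$. $\Phi_3(\alpha)$ is the unique natural transformation $\xi:\Sigma\to\mathbb{N}$ with $(\widetilde\alpha_{M,P})^{-1}\circ\alpha_{M,P}=\mathrm{Hom}_{\mathcal{M}}(M,\xi_P)$ for all $M\in\mathcal{M}$, $P\in\mathcal{P}$. These are bijections. Module structures: monoidal and module categories are assumed strict. $X^*$ is the left dual of $X\in\mathcal{C}$, with $\mathrm{ev}_X:X^*\otimes X\to\mathbb{1}$, $\mathrm{coev}_X:\mathbb{1}\to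 X\otimes X^*$; duality functors are assumed strict monoidal and mutually inverse. $\mathcal{C}$ acts linearly on $\mathcal{M}$ from the right if $\mathcal{M}$ is a right $\mathcal{C}$-module category, with action $\triangleleft$, such that each $(-)\triangleleft X$ is $k$-linear. $\mathcal{M}_{\mathbb{D}}$ is $\mathcal{M}$ with the action twisted by $\mathbb{D}(X)=X^{**}$. $\mathrm{Rex}_{\mathcal{C}}(\mathcal{M},\mathcal{M}_{\mathbb{D}})$ is the category of $k$-linear right exact right $\mathcal{C}$-module functors: objects are $k$-linear right exact $\Sigma:\mathcal{M}\to\mathcal{M}$ with natural isomorphisms $\Psi^\Sigma_{M,X}:\Sigma(M)\triangleleft X^{**}\to\Sigma(M\triangleleft X)$ satisfying $\Psi^\Sigma_{M,\mathbb{1}}=\mathrm{id}$, $\Psi^\Sigma_{M,X\otimes Y}=\Psi^\Sigma_{M\triangleleft X,Y}(\Psi^\Sigma_{M,X}\triangleleft\mathrm{id}_{Y^{**}})$; morphisms are natural transformations $\xi$ with $\xi_{M\triangleleft X}\Psi^\Sigma_{M,X}=\Psi^{\Sigma'}_{M,X}(\xi_M\triangleleft\mathrm{id}_{X^{**}})$. Closing operator: for $f:M\triangleleft X\to N\triangleleft X^{**}$, $\mathrm{cl}_{M,N|X}(f)=(\mathrm{id}_N\triangleleft\mathrm{ev}_{X^*})(f\triangleleft\mathrm{id}_{X^*})(\mathrm{id}_M\triangleleft\mathrm{coev}_X):M\to N$. $\mathbb{N}$ is an object of $\mathrm{Rex}_{\mathcal{C}}(\mathcal{M},\mathcal{M}_{\mathbb{D}})$,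 where $\Psi^{\mathbb{N}}_{M,V}:\mathbb{N}(M)\triangleleft V^{**}\to\mathbb{N}(M\triangleleft V)$ is the unique morphism with $\Psi^{\mathbb{N}}_{M,V}\circ(\mathbb{i}_{X,M}\triangleleft\mathrm{id}_{V^{**}})=\mathbb{i}_{X\triangleleft V^{**},M\triangleleft V}\circ((\mathrm{cl}_{M,X|V})^*\cdot\mathrm{id}_{X\triangleleft V^{**}})\circ\mathrm{can}$ for all $X\in\mathcal{M}$, with $\mathrm{can}:(\mathrm{Hom}_{\mathcal{M}}(M,X)^*\cdot X)\triangleleft V^{**}\cong\mathrm{Hom}_{\mathcal{M}}(M,X)^*\cdot(X\triangleleft V^{**})$ canonical. Module-compatibility: (a) $\mathtt{t}_\bullet\in\mathrm{Tr}(\Sigma)$ is module-compatible if $\mathtt{t}_P(\mathrm{cl}_{P,\Sigma(P)|X}(f))=\mathtt{t}_{P\triangleleft X}(\Psi^\Sigma_{P,X}\circ f)$ for all $P\in\mathcal{P}$, $X\in\mathcal{C}$, $f:P\triangleleft X\to\Sigma(P)\triangleleft X^{**}$. (b) $\xi:\Sigma\to\mathbb{N}$ is module-compatible if it is a morphism in $\mathrm{Rex}_{\mathcal{C}}(\mathcal{M},\mathcal{M}_{\mathbb{D}})$. (c) $\alpha:\mathbb{h}_\Sigma\to\mathbb{h}^*$ is module-compatible if $\langle\alpha_{M,P\triangleleft X}(\Psi^\Sigma_{P,X}\circ f^\flat),g\rangle=\langle\alpha_{M\triangleleft X^*,P}(f),g^\flat\rangle$ for all $M\in\mathcal{M}$,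 $P\in\mathcal{P}$, $X\in\mathcal{C}$, $f:M\triangleleft X^*\to\Sigma(P)$, $g:P\triangleleft X\to M$, where for $h:L\triangleleft Y\to L'$ one puts $h^\flat=(h\triangleleft\mathrm{id}_{Y^*})(\mathrm{id}_L\triangleleft\mathrm{coev}_Y):L\to L'\triangleleft Y^*$. *)

(* Defs.v *)
From HB Require Import structures.
From mathcomp Require Import all_boot all_algebra.
From mathcomp Require Import boolp.
From Stdlib Require Import ClassicalEpsilon.

Set Implicit Arguments.
Unset Strict Implicit.
Unset Printing Implicit Defensive.

Import GRing.Theory.

Local Open Scope ring_scope.

(* Definite description: the element satisfying P (junk value x0 if none). *)
Definition the (T : Type) (x0 : T) (P : T -> Prop) : T :=
  epsilon (inhabits x0) P.

(* f restricts to a bijection from the subset A to the subset B.  (MathComp's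
   [set_bij] would lead to a universe inconsistency below: its sets are too
   small for families indexed by the objects of a category.) *)
Definition restricts_to_bijection (T T' : Type) (A : T -> Prop) (B : T' -> Prop)
    (f : T -> T') : Prop :=
  [/\ forall x, A x -> B (f x),
      forall x y, A x -> A y -> f x = f y -> x = y
    & forall y, B y -> exists2 x, A x & f x = y].

Lemma linfunE (k : fieldType) (U V : vectType k) (f : U -> V) :
  linear f -> linfun f =1 f.
Proof.
move=> lf.
pose f' : {linear U -> V} := HB.pack f (GRing.isLinear.Build k U V *:%R f lf).
exact: (lfunE f').
Qed.

Definition dualV (k : fieldType) (V : vectType k) : vectType k := 'Hom(V, k^o).

Definition dualmap (k : fieldType) (V W : vectType k) (a : 'Hom(V, W)) :
    'Hom(dualV W, dualV V) :=
  linfun (fun w : dualV W => (w \o a)%VF : dualV V).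

Lemma dualmapE (k : fieldType) (V W : vectType k) (a : 'Hom(V, W))
    (w : dualV W) (v : V) : dualmap a w v = w (a v).
Proof.
rewrite /dualmap linfunE; first by rewrite comp_lfunE.
move=> c u u'; apply/lfunP=> x.
by rewrite !(comp_lfunE, add_lfunE, scale_lfunE).
Qed.

(** * Rigid monoidal categories (strict) *)

Record category := Category {
  ob :> Type;
  homC : ob -> ob -> Type;
  idm : forall X, homC X X;
  compC : forall X Y Z, homC Y Z -> homC X Y -> homC X Z;
  comp1m : forall X Y (f : homC X Y), compC (idm Y) f = f;
  compm1 : forall X Y (f : homC X Y), compC f (idm X) = f;
  compmA : forall X Y Z W (h : homC Z W) (g : homC Y Z) (f : homC X Y),
    compC h (compC g f) = compC (compC h g) f }.

Arguments idm {_} X.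
Notation "g \oc f" := (compC g f) (at level 50, left associativity).

(* The identity morphism of X, seen as a morphism X -> Y when X = Y. *)
Definition idto (C : category) (X Y : C) (e : X = Y) : homC X Y :=
  match e with erefl => idm X end.

(* Equality of morphisms whose sources and targets are equal objects, but not
   convertible ones. *)
Definition same (C : category) (X Y X' Y' : C) (f : homC X Y) (g : homC X' Y') :
    Prop :=
  exists (eX : X = X') (eY : Y = Y'), idto eY \oc f = g \oc idto eX.

(* Strict: the constraints are the identities [idto (tensA X Y Z)] etc., so
   their coherence is automatic and the laws on morphisms are equalities. *)
Record monoidal := Monoidal {
  mcat :> category;
  tunit : mcat;
  tens : mcat -> mcat -> mcat;
  tensm : forall X X' Y Y', homC X X' -> homC Y Y' ->
    homC (tens X Y) (tens X' Y');
  tensm_id : forall X Y, tensm (idm X) (idm Y) = idm (tens X Y);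
  tensm_comp : forall X X' X'' Y Y' Y'' (f' : homC X' X'') (f : homC X X')
      (g' : homC Y' Y'') (g : homC Y Y'),
    tensm (f' \oc f) (g' \oc g) = tensm f' g' \oc tensm f g;
  tensA : forall X Y Z, tens (tens X Y) Z = tens X (tens Y Z);
  tens1X : forall X, tens tunit X = X;
  tensX1 : forall X, tens X tunit = X;
  tensmA : forall X X' Y Y' Z Z' (f : homC X X') (g : homC Y Y') (h : homC Z Z'),
    same (tensm (tensm f g) h) (tensm f (tensm g h));
  tensm1f : forall X X' (f : homC X X'), same (tensm (idm tunit) f) f;
  tensmf1 : forall X X' (f : homC X X'), same (tensm f (idm tunit)) f }.

Arguments tunit {_}.
Notation "X ⊗ Y" := (tens X Y) (at level 40, left associativity).
Notation "f ⊗m g" := (tensm f g) (at level 40, left associativity).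

Record left_duality (C : monoidal) := LeftDuality {
  ld : C -> C;
  ev : forall X, homC (ld X ⊗ X) tunit;
  coev : forall X, homC tunit (X ⊗ ld X);
  ld_zig : forall X,
    same ((idm X ⊗m ev X) \oc idto (tensA X (ld X) X) \oc (coev X ⊗m idm X))
         (idm X);
  ld_zag : forall X,
    same ((ev X ⊗m idm (ld X)) \oc idto (esym (tensA (ld X) X (ld X)))
            \oc (idm (ld X) ⊗m coev X))
         (idm (ld X)) }.

Record right_duality (C : monoidal) := RightDuality {
  rd : C -> C;
  evr : forall X, homC (X ⊗ rd X) tunit;
  coevr : forall X, homC tunit (rd X ⊗ X);
  rd_zig : forall X,
    same ((evr X ⊗m idm X) \oc idto (esym (tensA X (rd X) X))
            \oc (idm X ⊗m coevr X))
         (idm X);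
  rd_zag : forall X,
    same ((idm (rd X) ⊗m evr X) \oc idto (tensA (rd X) X (rd X))
            \oc (coevr X ⊗m idm (rd X)))
         (idm (rd X)) }.

(* Y* = Y* ⊗ 1 -> Y* ⊗ (X ⊗ X* ) -> Y* ⊗ (Y ⊗ X* ) = (Y* ⊗ Y) ⊗ X* -> X* *)
Definition ldm (C : monoidal) (D : left_duality C) (X Y : C) (f : homC X Y) :
    homC (ld D Y) (ld D X) :=
  idto (tens1X (ld D X)) \oc (ev D Y ⊗m idm (ld D X))
    \oc idto (esym (tensA (ld D Y) Y (ld D X)))
    \oc (idm (ld D Y) ⊗m (f ⊗m idm (ld D X)))
    \oc (idm (ld D Y) ⊗m coev D X) \oc idto (esym (tensX1 (ld D Y))).

(* *Y = 1 ⊗ *Y -> ( *X ⊗ X) ⊗ *Y -> ( *X ⊗ Y) ⊗ *Y = *X ⊗ (Y ⊗ *Y) -> *X *)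
Definition rdm (C : monoidal) (D : right_duality C) (X Y : C) (f : homC X Y) :
    homC (rd D Y) (rd D X) :=
  idto (tensX1 (rd D X)) \oc (idm (rd D X) ⊗m evr D Y)
    \oc idto (tensA (rd D X) Y (rd D Y))
    \oc ((idm (rd D X) ⊗m f) ⊗m idm (rd D Y))
    \oc (coevr D X ⊗m idm (rd D Y)) \oc idto (esym (tens1X (rd D Y))).

(* The duality functors reverse the tensor product, and their canonical
   monoidal structure is the identity: this is what the conditions on the
   evaluations say.  *)
Record rigid := Rigid {
  rmon :> monoidal;
  ldual : left_duality rmon;
  rdual : right_duality rmon;
  ld_unit : ld ldual tunit = tunit;
  ld_tens : forall X Y, ld ldual (X ⊗ Y) = ld ldual Y ⊗ ld ldual X;
  ev_unit : same (ev ldual tunit) (idm tunit);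
  ev_tens : forall X Y,
    same (ev ldual (X ⊗ Y))
         (ev ldual Y \oc (idto (tensX1 (ld ldual Y)) ⊗m idm Y)
            \oc ((idm (ld ldual Y) ⊗m ev ldual X) ⊗m idm Y));
  rd_unit : rd rdual tunit = tunit;
  rd_tens : forall X Y, rd rdual (X ⊗ Y) = rd rdual Y ⊗ rd rdual X;
  evr_unit : same (evr rdual tunit) (idm tunit);
  evr_tens : forall X Y,
    same (evr rdual (X ⊗ Y))
         (evr rdual X \oc (idto (tensX1 X) ⊗m idm (rd rdual X))
            \oc ((idm X ⊗m evr rdual Y) ⊗m idm (rd rdual X)));
  ldK : forall X, ld ldual (rd rdual X) = X;
  rdK : forall X, rd rdual (ld ldual X) = X;
  ldmK : forall X Y (f : homC X Y), same (ldm ldual (rdm rdual f)) f;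
  rdmK : forall X Y (f : homC X Y), same (rdm rdual (ldm ldual f)) f }.

Notation "X ^∨" := (ld (ldual _) X) (at level 2, format "X ^∨").
Notation "u ^∨m" := (ldm (ldual _) u) (at level 2, format "u ^∨m").

(** * k-linear categories *)

(* Only k-linear categories with finite-dimensional Hom spaces occur. *)
Record lcategory (k : fieldType) := LCategory {
  lob :> Type;
  lhom : lob -> lob -> vectType k;
  lid : forall M, lhom M M;
  lcomp : forall M N L, lhom N L -> lhom M N -> lhom M L;
  lcomp1m : forall M N (f : lhom M N), lcomp (lid N) f = f;
  lcompm1 : forall M N (f : lhom M N), lcomp f (lid M) = f;
  lcompmA : forall M N L K (h : lhom L K) (g : lhom N L) (f : lhom M N),
    lcomp h (lcomp g f) = lcomp (lcomp h g) f;
  lcomp_linl : forall M N L (f : lhom M N),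
    linear (fun g : lhom N L => lcomp g f);
  lcomp_linr : forall M N L (g : lhom N L),
    linear (fun f : lhom M N => lcomp g f) }.

Arguments lid {_ _} M.
Notation "g \om f" := (lcomp g f) (at level 50, left associativity).

Definition lidto (k : fieldType) (Mc : lcategory k) (M N : Mc) (e : M = N) :
    lhom M N :=
  match e with erefl => lid M end.

Definition lsame (k : fieldType) (Mc : lcategory k) (M N M' N' : Mc)
    (f : lhom M N) (g : lhom M' N') : Prop :=
  exists (eM : M = M') (eN : N = N'), lidto eN \om f = g \om lidto eM.

Section LinearCategories.
Context {k : fieldType}.
Implicit Types Mc : lcategory k.

Definition postc Mc (M N L : Mc) (g : lhom N L) : 'Hom(lhom M N, lhom M L) :=
  linfun (fun f : lhom M N => g \om f).

Definition prec Mc (M N L : Mc) (f : lhom M N) : 'Hom(lhom N L, lhom M L) :=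
  linfun (fun g : lhom N L => g \om f).

Lemma postcE Mc (M N L : Mc) (g : lhom N L) (f : lhom M N) :
  postc M g f = g \om f.
Proof. by rewrite /postc linfunE //; exact: lcomp_linr. Qed.

Lemma precE Mc (M N L : Mc) (g : lhom N L) (f : lhom M N) :
  prec L f g = g \om f.
Proof. by rewrite /prec linfunE //; exact: lcomp_linl. Qed.

Definition inverse_of Mc (M N : Mc) (f : lhom M N) (g : lhom N M) : Prop :=
  g \om f = lid M /\ f \om g = lid N.

Definition is_iso Mc (M N : Mc) (f : lhom M N) : Prop :=
  exists g, inverse_of f g.

Definition linv Mc (M N : Mc) (f : lhom M N) : lhom N M :=
  the 0 (inverse_of f).

Definition epi Mc (M N : Mc) (e : lhom M N) : Prop :=
  forall L (g h : lhom N L), g \om e = h \om e -> g = h.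

Definition projective Mc (P : Mc) : Prop :=
  forall M N (e : lhom M N) (f : lhom P N), epi e ->
  exists g : lhom P M, e \om g = f.

Record proj Mc := Proj { pob :> lob Mc; pobP : projective pob }.

Definition is_coker Mc (M N L : Mc) (f : lhom M N) (p : lhom N L) : Prop :=
  p \om f = 0 /\
  forall K (q : lhom N K), q \om f = 0 -> exists! u : lhom L K, u \om p = q.

Record lfunctor Mc Mc' := LFunctor {
  fob :> Mc -> Mc';
  fmap : forall M N, 'Hom(lhom M N, lhom (fob M) (fob N));
  fmap_id : forall M, fmap M M (lid M) = lid (fob M);
  fmap_comp : forall M N L (g : lhom N L) (f : lhom M N),
    fmap M L (g \om f) = fmap N L g \om fmap M N f }.

Definition right_exact Mc Mc' (F : lfunctor Mc Mc') : Prop :=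
  forall M N L (f : lhom M N) (p : lhom N L),
    is_coker f p -> is_coker (fmap F M N f) (fmap F N L p).

Definition natural Mc Mc' (F G : lfunctor Mc Mc')
    (xi : forall M, lhom (F M) (G M)) : Prop :=
  forall M N (f : lhom M N), xi N \om fmap F M N f = fmap G M N f \om xi M.

Definition equivalent Mc Mc' : Prop :=
  exists (F : lfunctor Mc Mc') (G : lfunctor Mc' Mc)
    (eta : forall M : Mc, lhom M (G (F M)))
    (eps : forall N : Mc', lhom (F (G N)) N),
  [/\ forall M, is_iso (eta M), forall N, is_iso (eps N),
      forall M M' (f : lhom M M'),
        eta M' \om f = fmap G _ _ (fmap F _ _ f) \om eta M
    & forall N N' (f : lhom N N'),
        eps N' \om fmap F _ _ (fmap G _ _ f) = f \om eps N].

End LinearCategories.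

(** * Finite abelian categories *)

(* MathComp's algType excludes the zero algebra, whose module category is the
   zero category. *)
Record fdalg (k : fieldType) := FdAlg {
  acar :> vectType k;
  amul : acar -> acar -> acar;
  aone : acar;
  amulA : associative amul;
  amul1l : left_id aone amul;
  amul1r : right_id aone amul;
  amul_linl : forall b, linear (fun a => amul a b);
  amul_linr : forall a, linear (fun b => amul a b) }.

Record fdmod (k : fieldType) (A : fdalg k) := FdMod {
  mcar :> vectType k;
  mact : A -> mcar -> mcar;
  mactA : forall a b v, mact (amul a b) v = mact a (mact b v);
  mact1 : forall v, mact (aone A) v = v;
  mact_linl : forall v, linear (fun a => mact a v);
  mact_linr : forall a, linear (fun v => mact a v) }.

Section ModuleCategory.
Context {k : fieldType} (A : fdalg k).

Definition modmap_defect (V W : fdmod A) (f : 'Hom(V, W)) :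
    'Hom(A, 'Hom(V, W)) :=
  linfun (fun a => linfun (fun v : V => f (mact a v) - mact a (f v))).

Lemma modmap_defectE (V W : fdmod A) (f : 'Hom(V, W)) a v :
  modmap_defect f a v = f (mact a v) - mact a (f v).
Proof.
have L b : linfun (fun v : V => f (mact b v) - mact b (f v))
             =1 (fun v : V => f (mact b v) - mact b (f v)).
  apply: linfunE => c u u'; rewrite linearP !mact_linr linearP /=.
  by rewrite scalerBr opprD addrACA.
rewrite /modmap_defect linfunE ?L // => c b b'.
apply/lfunP => u; rewrite add_lfunE scale_lfunE !L !mact_linl linearP /=.
by rewrite scalerBr opprD addrACA.
Qed.

Definition modhom (V W : fdmod A) : {vspace 'Hom(V, W)} :=
  lker (linfun (@modmap_defect V W)).

Lemma modhomP (V W : fdmod A) (f : 'Hom(V, W)) :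
  reflect (forall a v, f (mact a v) = mact a (f v)) (f \in modhom V W).
Proof.
have L : linfun (@modmap_defect V W) =1 @modmap_defect V W.
  apply: linfunE => c g g'; apply/lfunP => a; apply/lfunP => v.
  rewrite !(add_lfunE, scale_lfunE) !modmap_defectE !(add_lfunE, scale_lfunE).
  by rewrite mact_linr scalerBr opprD addrACA.
rewrite memv_ker L; apply: (iffP eqP) => [H a v | H].
  by apply/eqP; rewrite -subr_eq0 -modmap_defectE H !zero_lfunE.
apply/lfunP => a; apply/lfunP => v.
by rewrite modmap_defectE H subrr !zero_lfunE.
Qed.

Definition mhom (V W : fdmod A) : vectType k := subvs_of (modhom V W).

Lemma mhomP (V W : fdmod A) (f : mhom V W) a v :
  vsval f (mact a v) = mact a (vsval f v).
Proof. exact: (modhomP _ (subvsP f)). Qed.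

Definition mkmhom (V W : fdmod A) (f : 'Hom(V, W))
    (fP : forall a v, f (mact a v) = mact a (f v)) : mhom V W :=
  Subvs (introT (modhomP f) fP).

Lemma mid_subproof (V : fdmod A) a v :
  (\1%VF : 'Hom(V, V)) (mact a v) = mact a ((\1%VF : 'Hom(V, V)) v).
Proof. by rewrite !id_lfunE. Qed.

Definition mid (V : fdmod A) : mhom V V := mkmhom (@mid_subproof V).

Lemma mcomp_subproof (U V W : fdmod A) (g : mhom V W) (f : mhom U V) a v :
  (vsval g \o vsval f)%VF (mact a v) = mact a ((vsval g \o vsval f)%VF v).
Proof. by rewrite !comp_lfunE !mhomP. Qed.

Definition mcomp (U V W : fdmod A) (g : mhom V W) (f : mhom U V) : mhom U W :=
  mkmhom (mcomp_subproof g f).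

Definition fdmodules : lcategory k.
Proof.
refine (@LCategory k (fdmod A) mhom mid mcomp _ _ _ _ _).
- by move=> V W f; apply: val_inj; rewrite /= comp_lfun1l.
- by move=> V W f; apply: val_inj; rewrite /= comp_lfun1r.
- by move=> V W U Z h g f; apply: val_inj; rewrite /= comp_lfunA.
- move=> V W U f c g g'; apply: val_inj; apply/lfunP => v.
  by rewrite /= !(comp_lfunE, add_lfunE, scale_lfunE).
- move=> V W U g c f f'; apply: val_inj; apply/lfunP => v.
  by rewrite /= !(comp_lfunE, add_lfunE, scale_lfunE) linearP.
Defined.

End ModuleCategory.

Definition finite_abelian (k : fieldType) (Mc : lcategory k) : Prop :=
  exists A : fdalg k, equivalent Mc (fdmodules A).

(** * The Nakayama functor *)

(* V . M represents N |-> Hom(V, Hom(M, N)); its functoriality in V and M is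
   the induced one (see cpw_map). *)
Record copowers (k : fieldType) (Mc : lcategory k) := Copowers {
  cpw :> vectType k -> Mc -> Mc;
  cpwI : forall V M N, 'Hom(lhom (cpw V M) N, 'Hom(V, lhom M N));
  cpwI_bij : forall V M N, bijective (cpwI V M N);
  cpwI_nat : forall V M N N' (h : lhom N N') (f : lhom (cpw V M) N),
    cpwI V M N' (h \om f) = (postc M h \o cpwI V M N f)%VF }.

Section Copowers.
Context {k : fieldType} {Mc : lcategory k} (cp : copowers Mc).

Definition cpw_unit (V : vectType k) (M : Mc) : 'Hom(V, lhom M (cp V M)) :=
  cpwI cp V M (cp V M) (lid (cp V M)).

Definition cpw_ext (V : vectType k) (M N : Mc) (g : 'Hom(V, lhom M N)) :
    lhom (cp V M) N :=
  ((cpwI cp V M N)^-1)%VF g.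

Definition cpw_map (V W : vectType k) (M N : Mc) (a : 'Hom(V, W))
    (f : lhom M N) : lhom (cp V M) (cp W N) :=
  cpw_ext (prec (cp W N) f \o cpw_unit W N \o a)%VF.

(* The canonical isomorphism F(V . M) ~ V . F(M) is the inverse of the
   morphism corresponding to v |-> F(v : M -> V . M). *)
Definition cpw_can (F : lfunctor Mc Mc) (V : vectType k) (M : Mc) :
    lhom (F (cp V M)) (cp V (F M)) :=
  linv (cpw_ext (fmap F M (cp V M) \o cpw_unit V M)%VF).

(* The image of w (x) f under V (x) Hom(P, X) ~ Hom(P, V . X). *)
Definition cpw_tens (V : vectType k) (P X : Mc) (w : V) (f : lhom P X) :
    lhom P (cp V X) :=
  cpw_unit V X w \om f.

Definition nak_arg (M X : Mc) : Mc := cp (dualV (lhom M X)) X.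

Definition dinatural (M Z : Mc) (j : forall X, lhom (nak_arg M X) Z) : Prop :=
  forall X Y (f : lhom X Y),
    j X \om cpw_map (dualmap (postc M f)) (lid X)
      = j Y \om cpw_map (\1%VF : 'Hom(dualV (lhom M Y), dualV (lhom M Y))) f.

(* nak M is the coend of (X', X) |-> Hom(M, X')^* . X, with universal dinatural
   transformation nak_i; nak_fmap is the functoriality induced on coends. *)
Record nakayama := Nakayama {
  nak :> lfunctor Mc Mc;
  nak_i : forall X M, lhom (nak_arg M X) (nak M);
  nak_dinat : forall M, dinatural (fun X => nak_i X M);
  nak_univ : forall M Z (j : forall X, lhom (nak_arg M X) Z), dinatural j ->
    exists! h : lhom (nak M) Z, forall X, h \om nak_i X M = j X;
  nak_fmap : forall M M' (f : lhom M M') X,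
    fmap nak M M' f \om nak_i X M
      = nak_i X M' \om cpw_map (dualmap (prec X f)) (lid X) }.

End Copowers.

(** * Twisted traces and the three bijections *)

Section Bijections.
Context {k : fieldType} {Mc : lcategory k}.
Implicit Types S : lfunctor Mc Mc.

Definition trfam S := forall P : proj Mc, dualV (lhom P (S P)).
Definition natfam S S' := forall M : Mc, lhom (S M) (S' M).
(* components of transformations Hom(M, S P) -> Hom(P, M)^* *)
Definition hfam S :=
  forall (M : Mc) (P : proj Mc), 'Hom(lhom M (S P), dualV (lhom P M)).

Definition is_trace S (t : trfam S) : Prop :=
  forall (P Q : proj Mc) (f : lhom P Q) (g : lhom Q (S P)),
    t P (g \om f) = t Q (fmap S P Q f \om g).

Definition is_nat_h S (al : hfam S) : Prop :=
  forall (M M' : Mc) (P Q : proj Mc) (a : lhom M' M) (b : lhom P Q)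
      (f : lhom M (S P)) (g : lhom Q M'),
    al M' Q (fmap S P Q b \om f \om a) g = al M P f (a \om g \om b).

Definition Phi2 S (t : trfam S) : hfam S := fun M P =>
  linfun (fun f : lhom M (S P) =>
    linfun (fun g : lhom P M => t P (f \om g)) : dualV (lhom P M)).

Lemma Phi2E S (t : trfam S) (M : Mc) (P : proj Mc) (f : lhom M (S P))
    (g : lhom P M) : Phi2 t M P f g = t P (f \om g).
Proof.
have L (h : lhom M (S P)) :
    (linfun (fun g : lhom P M => t P (h \om g)) : dualV (lhom P M))
      =1 (fun g : lhom P M => t P (h \om g)).
  by apply: linfunE => c u u'; rewrite lcomp_linr linearP.
rewrite /Phi2 linfunE ?L // => c u u'.
by apply/lfunP => x; rewrite add_lfunE scale_lfunE !L lcomp_linl linearP.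
Qed.

Variables (cp : copowers Mc) (N : nakayama cp).

Definition nak_trace : trfam N := fun P =>
  the 0 (fun t : dualV (lhom P (N P)) =>
    forall X (w : dualV (lhom P X)) (f : lhom P X),
      t (nak_i N X P \om cpw_tens cp w f) = w f).

(* <nak_alpha f, g> = nak_trace (f g) *)
Definition nak_alpha : hfam N := Phi2 nak_trace.

Definition Phi1 S (xi : natfam S N) : trfam S := fun P =>
  (nak_trace P \o postc P (xi P))%VF.

Definition Phi3 S (al : hfam S) : natfam S N :=
  the (fun _ => 0) (fun xi => natural xi /\
    forall (M : Mc) (P : proj Mc),
      ((nak_alpha M P)^-1 \o al M P)%VF = postc M (xi P)).

End Bijections.

(** * Module categories *)

Record rmodcat (k : fieldType) (C : rigid) (Mc : lcategory k) := RModCat {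
  ract : Mc -> C -> Mc;
  actm : forall M N X Y, lhom M N -> homC X Y -> lhom (ract M X) (ract N Y);
  actm_id : forall M X, actm (lid M) (idm X) = lid (ract M X);
  actm_comp : forall M N L X Y Z (g : lhom N L) (f : lhom M N)
      (v : homC Y Z) (u : homC X Y),
    actm (g \om f) (v \oc u) = actm g v \om actm f u;
  actm_lin : forall M N X, linear (fun f : lhom M N => actm f (idm X));
  actA : forall M X Y, ract (ract M X) Y = ract M (X ⊗ Y);
  act1 : forall M, ract M tunit = M;
  actmA : forall M N X X' Y Y' (f : lhom M N) (u : homC X X') (v : homC Y Y'),
    lsame (actm (actm f u) v) (actm f (u ⊗m v));
  actm1 : forall M N (f : lhom M N), lsame (actm f (idm tunit)) f }.

Section ModuleCategories.
Context {k : fieldType} {C : rigid} {Mc : lcategory k} (R : rmodcat C Mc).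
Implicit Types (M N L : Mc) (X Y : C).

Local Notation "M ◁ X" := (ract R M X) (at level 45, left associativity).
Local Notation "f ◁m u" := (actm R f u) (at level 45, left associativity).

Definition actf_map X M N : 'Hom(lhom M N, lhom (M ◁ X) (N ◁ X)) :=
  linfun (fun f : lhom M N => f ◁m idm X).

Lemma actf_mapE X M N (f : lhom M N) : actf_map X M N f = f ◁m idm X.
Proof. by rewrite /actf_map linfunE //; exact: actm_lin. Qed.

Definition actf X : lfunctor Mc Mc.
Proof.
refine (@LFunctor k Mc Mc (fun M => M ◁ X) (actf_map X) _ _).
- by move=> M; rewrite actf_mapE actm_id.
- by move=> M N L g f; rewrite !actf_mapE -actm_comp comp1m.
Defined.

(* M -> (M ◁ X) ◁ X* *)
Definition unitX M X : lhom M (M ◁ X ◁ X^∨) :=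
  lidto (esym (actA R M X X^∨)) \om (lid M ◁m coev (ldual C) X)
    \om lidto (esym (act1 R M)).

(* (M ◁ X* ) ◁ X -> M *)
Definition counitX M X : lhom (M ◁ X^∨ ◁ X) M :=
  lidto (act1 R M) \om (lid M ◁m ev (ldual C) X) \om lidto (actA R M X^∨ X).

Definition cl M N X (f : lhom (M ◁ X) (N ◁ X^∨^∨)) : lhom M N :=
  counitX N X^∨ \om (f ◁m idm X^∨) \om unitX M X.

Definition clmap M N X : 'Hom(lhom (M ◁ X) (N ◁ X^∨^∨), lhom M N) :=
  linfun (@cl M N X).

Lemma clmapE M N X f : clmap M N X f = cl f.
Proof.
rewrite /clmap linfunE // => c g h.
by rewrite /cl actm_lin lcomp_linr lcomp_linl.
Qed.

Definition flat L L' Y (h : lhom (L ◁ Y) L') : lhom L (L' ◁ Y^∨) :=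
  (h ◁m idm Y^∨) \om unitX L Y.

(* Mutually inverse to [flat]; used to show that - ◁ X preserves projectives. *)
Definition sharp L L' Y (h : lhom L (L' ◁ Y^∨)) : lhom (L ◁ Y) L' :=
  counitX L' Y \om (h ◁m idm Y).

Lemma idto_irr (D : category) (X Y : D) (e e' : X = Y) : idto e = idto e'.
Proof. by rewrite (Prop_irrelevance e e'). Qed.

Lemma idtoK (D : category) (X Y : D) (e : X = Y) :
  idto (esym e) \oc idto e = idm X.
Proof. by case: Y / e; rewrite comp1m. Qed.

Lemma lidto_irr M N (e e' : M = N) : lidto e = lidto e'.
Proof. by rewrite (Prop_irrelevance e e'). Qed.

Lemma lidto_comp M N L (e : M = N) (e' : N = L) :
  lidto e' \om lidto e = lidto (etrans e e').
Proof. by case: L / e'; rewrite lcomp1m. Qed.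

Lemma lidto_act M N X (e : M = N) :
  lidto e ◁m idm X = lidto (congr1 (ract R ^~ X) e).
Proof. by case: N / e; rewrite actm_id. Qed.

Lemma act_idto M X Y (e : X = Y) :
  lid M ◁m idto e = lidto (congr1 (ract R M) e).
Proof. by case: Y / e; rewrite actm_id. Qed.

Lemma lidtoK M N (e : M = N) (e' : N = M) : lidto e' \om lidto e = lid M.
Proof. by rewrite lidto_comp (lidto_irr _ erefl). Qed.

Lemma actmA_nat M N X X' Y Y' (f : lhom M N) (u : homC X X') (v : homC Y Y') :
  lidto (actA R N X' Y') \om ((f ◁m u) ◁m v)
    = (f ◁m (u ⊗m v)) \om lidto (actA R M X Y).
Proof.
have [e [e' H]] := actmA R f u v.
by rewrite (lidto_irr _ e') H (lidto_irr _ e).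
Qed.

Lemma actm1_nat M N (f : lhom M N) :
  lidto (act1 R N) \om (f ◁m idm tunit) = f \om lidto (act1 R M).
Proof.
have [e [e' H]] := actm1 R f.
by rewrite (lidto_irr _ e') H (lidto_irr _ e).
Qed.

Lemma actmA_conj M N X X' Y Y' (f : lhom M N) (u : homC X X') (v : homC Y Y') :
  (f ◁m u) ◁m v
    = lidto (esym (actA R N X' Y')) \om (f ◁m (u ⊗m v))
        \om lidto (actA R M X Y).
Proof. by rewrite -lcompmA -actmA_nat lcompmA lidtoK lcomp1m. Qed.

Lemma actm1_conj M N (f : lhom M N) :
  f ◁m idm tunit = lidto (esym (act1 R N)) \om f \om lidto (act1 R M).
Proof. by rewrite -lcompmA -actm1_nat lcompmA lidtoK lcomp1m. Qed.

Lemma actm_compl M N L X (g : lhom N L) (f : lhom M N) :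
  (g \om f) ◁m idm X = (g ◁m idm X) \om (f ◁m idm X).
Proof. by rewrite -actm_comp comp1m. Qed.

Lemma actm_swap M N X Y (f : lhom M N) (u : homC X Y) :
  (lid N ◁m u) \om (f ◁m idm X) = (f ◁m idm Y) \om (lid M ◁m u).
Proof. by rewrite -!actm_comp !comp1m !compm1 lcomp1m lcompm1. Qed.

Lemma counitX_nat M N X (f : lhom M N) :
  counitX N X \om ((f ◁m idm X^∨) ◁m idm X) = f \om counitX M X.
Proof.
rewrite /counitX -[LHS]lcompmA actmA_nat tensm_id -lcompmA (lcompmA (_ ◁m _)).
by rewrite actm_swap !lcompmA actm1_nat.
Qed.

Lemma unitX_nat M N X (f : lhom M N) :
  ((f ◁m idm X) ◁m idm X^∨) \om unitX M X = unitX N X \om f.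
Proof.
rewrite /unitX actmA_conj tensm_id !lcompmA -(lcompmA _ (lidto _) (lidto _)).
rewrite lidtoK lcompm1 -(lcompmA _ _ (_ ◁m coev _ _)) -actm_swap actm1_conj.
by rewrite -!lcompmA lidtoK lcompm1.
Qed.

Lemma flat_natr M L L' Y (h : lhom (L ◁ Y) L') (f : lhom M L) :
  flat (h \om (f ◁m idm Y)) = flat h \om f.
Proof. by rewrite /flat actm_compl -[LHS]lcompmA unitX_nat lcompmA. Qed.

Lemma sharp_natl M L L' Y (h : lhom L (L' ◁ Y^∨)) (f : lhom L' M) :
  sharp ((f ◁m idm Y^∨) \om h) = f \om sharp h.
Proof. by rewrite /sharp actm_compl lcompmA counitX_nat lcompmA. Qed.

Lemma triangleX L Y :
  counitX (L ◁ Y) Y \om (unitX L Y ◁m idm Y) = lid (L ◁ Y).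
Proof.
have [eX [eY zig]] := ld_zig (ldual C) Y.
rewrite /counitX /unitX !actm_compl !lidto_act -(actm_id R L Y) !actmA_conj.
set a := lid L ◁m (idm Y ⊗m _); set b := lid L ◁m (_ ⊗m idm Y).
have ab : a \om lidto (congr1 (ract R L) (tensA Y Y^∨ Y)) \om b
    = lidto (congr1 (ract R L) (esym eY)) \om lidto (congr1 (ract R L) eX).
  rewrite -!act_idto -!actm_comp !lcomp1m; congr (actm _ _ _).
  by rewrite -[in RHS](comp1m (idto eX)) -zig compmA idtoK comp1m.
rewrite !lcompmA -(lcompmA _ (lidto (actA R L tunit Y))) !lidto_comp.
do 3!rewrite -(lcompmA _ (lidto _) (lidto _)) lidto_comp.
rewrite (lidto_irr _ (congr1 (ract R L) (tensA Y Y^∨ Y))).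
rewrite -(lcompmA (lidto _) a) -(lcompmA (lidto _) _ b) ab actm_id.
by rewrite !lidto_comp (lidto_irr _ erefl).
Qed.

Lemma flatK L L' Y (h : lhom (L ◁ Y) L') : sharp (flat h) = h.
Proof.
rewrite /sharp /flat actm_compl lcompmA counitX_nat.
by rewrite -[LHS]lcompmA triangleX lcompm1.
Qed.

Lemma act_epi M N X (e : lhom M N) : epi e -> epi (e ◁m idm X^∨).
Proof.
move=> epe L g h; move/(congr1 (@flat _ _ _)).
by rewrite !flat_natr => /epe/(congr1 (@sharp _ _ _)); rewrite !flatK.
Qed.

Lemma act_projective P X : projective P -> projective (P ◁ X).
Proof.
move=> prP M N e f epe.
have [g gP] := prP _ _ _ (flat f) (act_epi (X := X) epe).
by exists (sharp g); rewrite -sharp_natl gP flatK.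
Qed.

Definition actP (P : proj Mc) X : proj Mc :=
  Proj (@act_projective P X (@pobP k Mc P)).

(** * The category Rex_C(M, M_D) and module-compatibility *)

(* Since D is strict, Psi_unit reads Psi_{M,1} = id and both sides of Psi_tens
   go from S(M) ◁ X** ◁ Y** to S(M ◁ X ◁ Y). *)
Record rexfun := RexFun {
  rexf :> lfunctor Mc Mc;
  rexf_exact : right_exact rexf;
  Psi : forall M X, lhom (rexf M ◁ X^∨^∨) (rexf (M ◁ X));
  Psi_iso : forall M X, is_iso (Psi M X);
  Psi_nat : forall M N X Y (f : lhom M N) (u : homC X Y),
    Psi N Y \om (fmap rexf M N f ◁m u^∨m^∨m)
      = fmap rexf _ _ (f ◁m u) \om Psi M X;
  Psi_unit : forall M, lsame (Psi M tunit) (lid (rexf M));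
  Psi_tens : forall M X Y,
    lsame (Psi M (X ⊗ Y))
          (Psi (M ◁ X) Y \om (Psi M X ◁m idm Y^∨^∨)) }.

Variables (cp : copowers Mc) (N : nakayama cp).

Definition nak_Psi M (V : C) : lhom (N M ◁ V^∨^∨) (N (M ◁ V)) :=
  the 0 (fun psi : lhom (N M ◁ V^∨^∨) (N (M ◁ V)) => forall L,
    psi \om (nak_i N L M ◁m idm V^∨^∨)
      = nak_i N (L ◁ V^∨^∨) (M ◁ V)
          \om cpw_map cp (dualmap (clmap M L V)) (lid (L ◁ V^∨^∨))
          \om cpw_can cp (actf V^∨^∨) (dualV (lhom M L)) L).

Variable S : rexfun.

Definition compatible_trace (t : trfam S) : Prop :=
  forall (P : proj Mc) X (f : lhom (P ◁ X) (S P ◁ X^∨^∨)),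
    t P (cl f) = t (actP P X) (Psi S P X \om f).

Definition compatible_nat (xi : natfam S N) : Prop :=
  forall M X,
    xi (M ◁ X) \om Psi S M X = nak_Psi M X \om (xi M ◁m idm X^∨^∨).

Definition compatible_nat_h (al : hfam S) : Prop :=
  forall M (P : proj Mc) X (f : lhom (M ◁ X^∨) (S P)) (g : lhom (P ◁ X) M),
    al M (actP P X) (Psi S P X \om flat f) g = al (M ◁ X^∨) P f (flat g).

End ModuleCategories.

(* Main.v *)
Require Import Defs.
From mathcomp Require Import all_boot all_algebra.
From mathcomp Require Import boolp.
From Stdlib Require Import ClassicalEpsilon.

(* The universal dinatural transformation assigns to w in Hom(M, X)^* a morphism
   [nak_in w] : X -> N M, and these morphisms jointly determine maps out of N M.
   If G is the image of the regular module, then w |-> nak_in w is a bijection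
   Hom(M, G)^* -> Hom(G, N M); via a dual basis of a projective P over G this
   yields the trace with t_P (nak_in w o f) = w f.  Consequently the inverse of
   alpha_{M,P} is [nak_in] itself, and the identity of N P is [nak_in t_P].
   The same description gives Psi o (nak_in w ◁ X** ) = nak_in (w o cl), whence
   the canonical trace is module-compatible.  Everything about a natural
   transformation out of a right exact functor can be checked on projectives,
   and there the non-degeneracy of the trace turns each of the three
   compatibility conditions into the others. *)

Set Implicit Arguments.
Unset Strict Implicit.
Unset Printing Implicit Defensive.

Import GRing.Theory.

(** * Linear categories, copowers and the coend *)

Lemma theP (T : Type) (x0 : T) (P : T -> Prop) : (exists x, P x) -> P (the x0 P).
Proof. exact: epsilon_spec. Qed.

Section LinearAlgebra.
Local Open Scope ring_scope.
Context {k : fieldType}.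

Lemma lfun_bijK (V W : vectType k) (f : 'Hom(V, W)) :
  bijective f -> cancel f^-1%VF f.
Proof.
case=> g fK gK w; apply: limg_lfunVK.
by apply/memv_imgP; exists (g w); rewrite ?memvf ?gK.
Qed.

Lemma lfun_injK (V W : vectType k) (f : 'Hom(V, W)) :
  injective f -> cancel f f^-1%VF.
Proof. by move=> f_inj; apply: lker0_lfunK; apply/lker0P. Qed.

(** Subtracting the projection onto [U] kills [U] but not [w]; some basis coordinate of what remains
    of [w] is nonzero. *)
Lemma separating_functional (W : vectType k) (U : {vspace W}) (w : W) :
  w \notin U -> exists2 l : dualV W, forall u, u \in U -> l u = 0 & l w != 0.
Proof.
move=> wU.
pose p : 'End(W) := (\1 - projv U)%VF.
have pE u : p u = u - projv U u by rewrite add_lfunE opp_lfunE id_lfunE.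
have pw : p w != 0.
  apply: contra wU; rewrite pE subr_eq0 => /eqP->; exact: memv_proj.
have [i ci] : exists i, coord (vbasis fullv) i (p w) != 0.
  apply/existsP; apply: contraNT pw; rewrite negb_exists => /forallP c0.
  rewrite (coord_vbasis (memvf (p w))) big1 // => i _.
  by move: (c0 i); rewrite negbK => /eqP->; rewrite scale0r.
pose l : dualV W := linfun (fun v => coord (vbasis fullv) i (p v) : k^o).
have lE : l =1 (fun v => coord (vbasis fullv) i (p v) : k^o).
  by apply: linfunE => c u v; rewrite !linearP.
exists l; last by rewrite lE.
by move=> u uU; rewrite lE pE projv_id // subrr linear0.
Qed.

End LinearAlgebra.

Section LinearCategories.
Local Open Scope ring_scope.
Context {k : fieldType} {Mc : lcategory k}.

Lemma lcomp0f (M N L : Mc) (f : lhom M N) : (0 : lhom N L) \om f = 0.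
Proof. by rewrite -precE linear0. Qed.

Lemma lcompf0 (M N L : Mc) (g : lhom N L) : g \om (0 : lhom M N) = 0.
Proof. by rewrite -postcE linear0. Qed.

Lemma lcomp_suml (I : Type) (r : seq I) (M N L : Mc) (g : I -> lhom N L)
    (f : lhom M N) :
  (\sum_(i <- r) g i) \om f = \sum_(i <- r) (g i \om f).
Proof.
by rewrite -precE linear_sum; apply: eq_bigr => i _ /=; rewrite precE.
Qed.

Lemma lcomp_sumr (I : Type) (r : seq I) (M N L : Mc) (f : I -> lhom M N)
    (g : lhom N L) :
  g \om (\sum_(i <- r) f i) = \sum_(i <- r) (g \om f i).
Proof.
by rewrite -postcE linear_sum; apply: eq_bigr => i _ /=; rewrite postcE.
Qed.

Lemma coker_epi (M N L : Mc) (f : lhom M N) (p : lhom N L) :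
  is_coker f p -> epi p.
Proof.
case=> pf univ K g h gh.
have [u [_ uP]] := univ K (g \om p) ltac:(by rewrite -lcompmA pf lcompf0).
by rewrite -(uP g) // -(uP h).
Qed.

Lemma linvP (M N : Mc) (f : lhom M N) : is_iso f -> inverse_of f (linv f).
Proof. exact: theP. Qed.

End LinearCategories.

Section Copowers.
Local Open Scope ring_scope.
Context {k : fieldType} {Mc : lcategory k} (cp : copowers Mc).

Local Notation cpu := (cpw_unit cp).

Lemma cpwIE (V : vectType k) (M N : Mc) (f : lhom (cp V M) N) v :
  cpwI cp V M N f v = f \om cpu V M v.
Proof. by rewrite -[f in LHS]lcompm1 cpwI_nat comp_lfunE postcE. Qed.

Lemma cpw_extE (V : vectType k) (M N : Mc) (g : 'Hom(V, lhom M N)) v :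
  cpw_ext cp g \om cpu V M v = g v.
Proof. by rewrite -cpwIE /cpw_ext lfun_bijK //; exact: cpwI_bij. Qed.

Lemma cpw_ext_fun (V : vectType k) (M N : Mc) (g : V -> lhom M N) :
  linear g -> exists f : lhom (cp V M) N, forall v, f \om cpu V M v = g v.
Proof.
by move=> lg; exists (cpw_ext cp (linfun g)) => v; rewrite cpw_extE linfunE.
Qed.

Lemma cpw_eq (V : vectType k) (M N : Mc) (f g : lhom (cp V M) N) :
  (forall v, f \om cpu V M v = g \om cpu V M v) -> f = g.
Proof.
move=> fg; apply: (bij_inj (cpwI_bij cp V M N)).
by apply/lfunP => v; rewrite [LHS]cpwIE [RHS]cpwIE fg.
Qed.

Lemma cpw_mapE (V W : vectType k) (M N : Mc) (a : 'Hom(V, W)) (f : lhom M N) v :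
  cpw_map cp a f \om cpu V M v = cpu W N (a v) \om f.
Proof. by rewrite /cpw_map cpw_extE !comp_lfunE precE. Qed.

End Copowers.

(** * The coend as a representing object *)

Section NakayamaCalculus.
Local Open Scope ring_scope.
Context {k : fieldType} {Mc : lcategory k} {cp : copowers Mc}.
Context (N : nakayama cp).

Local Notation cpu := (cpw_unit cp).

(* By dinaturality, the coend N M represents the natural transformations
   Hom(M, -)^* -> Hom(-, Z); [nak_in] is the universal one.  It is locked to
   keep [lcompmA] from matching inside it. *)
Definition nak_in (M X : Mc) (w : dualV (lhom M X)) : lhom X (N M) :=
  locked (nak_i N X M \om cpu (dualV (lhom M X)) X w).

Lemma nak_inE (M X : Mc) (w : dualV (lhom M X)) :
  nak_in w = nak_i N X M \om cpu (dualV (lhom M X)) X w.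
Proof. by rewrite /nak_in -lock. Qed.

Lemma nak_in_linear (M X : Mc) : linear (@nak_in M X).
Proof. by move=> c u v; rewrite !nak_inE linearP lcomp_linr. Qed.

Definition dual_post (M X Y : Mc) (f : lhom X Y) (w : dualV (lhom M Y)) :
  dualV (lhom M X) := dualmap (postc M f) w.

Definition dual_pre (M M' X : Mc) (f : lhom M M') (w : dualV (lhom M X)) :
  dualV (lhom M' X) := dualmap (prec X f) w.

Lemma dual_postE (M X Y : Mc) (f : lhom X Y) (w : dualV (lhom M Y)) g :
  dual_post f w g = w (f \om g).
Proof. by rewrite /dual_post dualmapE postcE. Qed.

Lemma dual_preE (M M' X : Mc) (f : lhom M M') (w : dualV (lhom M X)) g :
  dual_pre f w g = w (g \om f).
Proof. by rewrite /dual_pre dualmapE precE. Qed.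

Lemma nak_in_comp (M X Y : Mc) (w : dualV (lhom M Y)) (f : lhom X Y) :
  nak_in w \om f = nak_in (dual_post f w).
Proof.
have := congr1 (fun h => h \om cpu _ _ w) (nak_dinat N M f).
by rewrite !nak_inE -!lcompmA !cpw_mapE id_lfunE lcompm1 !lcompmA => <-.
Qed.

Lemma nak_in_fmap (M M' X : Mc) (f : lhom M M') (w : dualV (lhom M X)) :
  fmap N M M' f \om nak_in w = nak_in (dual_pre f w).
Proof.
have := congr1 (fun h => h \om cpu _ _ w) (nak_fmap N f X).
by rewrite !nak_inE -!lcompmA cpw_mapE lcompm1.
Qed.

Lemma nak_eq (M Z : Mc) (h h' : lhom (N M) Z) :
  (forall X (w : dualV (lhom M X)), h \om nak_in w = h' \om nak_in w) -> h = h'.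
Proof.
move=> hh'.
have [|g [_ gP]] := @nak_univ _ _ _ N M Z (fun X => h \om nak_i N X M).
  by move=> X Y f; rewrite -!lcompmA (nak_dinat N M f).
rewrite -(gP h) // -(gP h') // => X; apply: (@cpw_eq _ _ cp) => w.
by have := hh' X w; rewrite !nak_inE !lcompmA.
Qed.

(** Existence half of the universal property, with dinatural families on copowers traded for natural
    families of linear maps; uniqueness is [nak_eq]. *)
Lemma nak_desc (M Z : Mc) (j : forall X, dualV (lhom M X) -> lhom X Z) :
    (forall X, linear (j X)) ->
    (forall X Y (f : lhom X Y) w, j Y w \om f = j X (dual_post f w)) ->
  exists h : lhom (N M) Z, forall X w, h \om nak_in w = j X w.
Proof.
move=> lj nj.
pose j' X : lhom (nak_arg cp M X) Z := cpw_ext cp (linfun (j X)).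
have j'E X w : j' X \om cpu _ X w = j X w by rewrite cpw_extE linfunE.
have [|h [hP _]] := @nak_univ _ _ _ N M Z j'.
  move=> X Y f; apply: (@cpw_eq _ _ cp) => w.
  by rewrite -!lcompmA !cpw_mapE id_lfunE lcompm1 lcompmA !j'E nj.
by exists h => X w; rewrite !nak_inE lcompmA hP j'E.
Qed.

End NakayamaCalculus.

(** * A generator of a finite abelian category *)

Section Generators.
Local Open Scope ring_scope.
Context {k : fieldType}.

(* Hom(G, -) behaves like the forgetful functor of the category of right
   End(G)-modules; [generator_dual] realizes the modules Hom(M, G)^*. *)
Record is_generator (Mc : lcategory k) (G : Mc) : Prop := IsGenerator {
  generator_eq : forall (X Y : Mc) (f g : lhom X Y),
    (forall x : lhom G X, f \om x = g \om x) -> f = g;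
  generator_full : forall (X Y : Mc) (phi : lhom G X -> lhom G Y), linear phi ->
    (forall x r, phi (x \om r) = phi x \om r) ->
    exists f, forall x, phi x = f \om x;
  generator_dual : forall M : Mc,
    exists (Z : Mc) (theta : dualV (lhom M G) -> lhom G Z),
    [/\ linear theta, bijective theta
      & forall w r, theta (dual_post r w) = theta w \om r] }.

Lemma is_iso_cancelr (Mc : lcategory k) (M N L : Mc) (e : lhom M N)
    (f g : lhom N L) : is_iso e -> f \om e = g \om e -> f = g.
Proof.
case=> e' [_ ee'] fg; rewrite -[f]lcompm1 -[g]lcompm1 -ee' !lcompmA fg //.
Qed.

Lemma is_iso_cancell (Mc : lcategory k) (M N L : Mc) (e : lhom N L)
    (f g : lhom M N) : is_iso e -> e \om f = e \om g -> f = g.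
Proof.
case=> e' [e'e _] fg; rewrite -[f]lcomp1m -[g]lcomp1m -e'e -!lcompmA fg //.
Qed.

Lemma linvK (Mc : lcategory k) (M N : Mc) (e : lhom M N) :
  is_iso e -> e \om linv e = lid N.
Proof. by move/linvP => []. Qed.

Definition faithful (Mc Mc' : lcategory k) (F : lfunctor Mc Mc') :=
  forall (X Y : Mc) (f g : lhom X Y), fmap F X Y f = fmap F X Y g -> f = g.

Definition full (Mc Mc' : lcategory k) (F : lfunctor Mc Mc') :=
  forall (X Y : Mc) (g : lhom (F X) (F Y)), exists f, fmap F X Y f = g.

Lemma equivalent_faithful_full (Mc Mc' : lcategory k) :
  equivalent Mc Mc' ->
  exists F : lfunctor Mc Mc', [/\ faithful F, full F
    & forall N : Mc', exists (M : Mc) (e : lhom N (F M)), is_iso e].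
Proof.
case=> F [G [eta [eps [eta_iso eps_iso eta_nat eps_nat]]]].
have faithF : faithful F.
  move=> X Y f g fg; apply: (is_iso_cancell (eta_iso Y)).
  by rewrite !eta_nat fg.
have faithG : faithful G.
  move=> X Y f g fg; apply: (is_iso_cancelr (eps_iso X)).
  by rewrite -!eps_nat fg.
exists F; split=> // [X Y g|L].
  exists (linv (eta Y) \om fmap G _ _ g \om eta X).
  (* Since [G] is faithful, the equation may be tested after [G], where naturality of [eta] undoes
     the conjugation. *)
  apply: faithG; apply: (is_iso_cancelr (eta_iso X)).
  by rewrite -eta_nat !lcompmA linvK // lcomp1m.
exists (G L), (linv (eps L)); exists (eps L).
by have [] := linvP (eps_iso L); split.
Qed.

End Generators.

Section ModuleCategories.
Local Open Scope ring_scope.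
Context {k : fieldType} (A : fdalg k).

Definition regular : fdmod A :=
  @FdMod k A A (@amul k A) (fun a b v => esym (amulA a b v))
    (@amul1l k A) (@amul_linl k A) (@amul_linr k A).

Lemma mhom_eq (V W : fdmod A) (f g : mhom V W) :
  (forall v, vsval f v = vsval g v) -> f = g.
Proof. by move=> fg; apply: val_inj; apply/lfunP. Qed.

Lemma mhom_fun (V W : fdmod A) (f : V -> W) :
    linear f -> (forall a v, f (mact a v) = mact a (f v)) ->
  exists g : mhom V W, vsval g =1 f.
Proof.
move=> lf fA.
have fP a v : linfun f (mact a v) = mact a (linfun f v).
  by rewrite !linfunE // fA.
by exists (mkmhom fP) => v; rewrite /= linfunE.
Qed.

Lemma regular_rep (V : fdmod A) (v : V) :
  exists g : mhom regular V, vsval g (aone A) = v.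
Proof.
have [] := @mhom_fun regular V (fun a => mact a v).
- exact: mact_linl.
- by move=> a b; rewrite mactA.
by move=> g gP; exists g; rewrite gP mact1.
Qed.

Lemma regular_eq (V : fdmod A) (f g : mhom regular V) :
  vsval f (aone A) = vsval g (aone A) -> f = g.
Proof.
move=> fg; apply: mhom_eq => a.
by rewrite -[a](amul1r (a : A)) !(mhomP _ a (aone A : regular)) fg.
Qed.

End ModuleCategories.

Section GeneratorExists.
Local Open Scope ring_scope.
Context {k : fieldType} {Mc : lcategory k}.

(** [G] corresponds to the regular module and [e] to its unit. Evaluation [el] at [e] identifies
    Hom(G, X) with the underlying space of [F X], so the three properties come from faithfulness,
    fullness and essential surjectivity of [F]. *)
Lemma finite_abelian_generator :
  finite_abelian Mc -> exists G : Mc, is_generator G.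
Proof.
case=> A /equivalent_faithful_full[F [faithF fullF surjF]].
have [G [i [i' [i'i ii']]]] := surjF (regular A).
pose e : mcar (F G) := vsval i (aone A).
have i'e : vsval i' e = aone A.
  have := congr1 (fun f : mhom (regular A) (regular A) => vsval f (aone A)) i'i.
  by rewrite /= comp_lfunE id_lfunE.
pose el X (x : lhom G X) : mcar (F X) := vsval (fmap F G X x) e.
have elM X Y (f : lhom X Y) x : el Y (f \om x) = vsval (fmap F X Y f) (el X x).
  by rewrite /el fmap_comp /= comp_lfunE.
have el_lin X : linear (el X).
  by move=> c x y; rewrite /el linearP /= add_lfunE scale_lfunE.
have el_inj X : injective (el X).
  move=> x y xy; apply: faithF; apply: (@is_iso_cancelr _ _ _ _ _ i).
    by exists i'; split.
  by apply: regular_eq; rewrite /= !comp_lfunE.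
have el_surj X m : exists x, el X x = m.
  have [g gm] := regular_rep m.
  have [x xP] := fullF _ _ ((g : lhom (regular A : fdmodules A) (F X)) \om i').
  by exists x; rewrite /el xP /= comp_lfunE i'e.
pose elV X (m : mcar (F X)) : lhom G X := the 0 (fun x => el X x = m).
have elVK X : cancel (elV X) (el X) by move=> m; apply: theP (el_surj X m).
have elK X : cancel (el X) (elV X) by move=> x; apply: el_inj; rewrite elVK.
(* [r a] corresponds to right multiplication by [a]; precomposing with it is the action of [a] on
   elements. *)
pose r a := elV G (mact a e).
have elr X (x : lhom G X) a : el X (x \om r a) = mact a (el X x).
  by rewrite elM elVK mhomP.
have r_surj s : exists a, s = r a.
  exists (vsval i' (el G s)); apply: el_inj; rewrite elVK.
  rewrite -mhomP; set a := vsval i' _.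
  have -> : mact a (aone A : regular A) = a by apply: amul1r.
  have := congr1 (fun f : mhom (F G) (F G) => vsval f (el G s)) ii'.
  by rewrite /= comp_lfunE id_lfunE.
exists G; split.
- move=> X Y f g fg; apply: faithF; apply: mhom_eq => m.
  by rewrite -[m](elVK X) -!elM fg.
- move=> X Y phi lphi phir.
  have [] := @mhom_fun _ _ (F X) (F Y) (fun m => el Y (phi (elV X m))).
  + move=> c u v; rewrite -el_lin -lphi; congr (el _ (phi _)).
    by apply: el_inj; rewrite el_lin !elVK.
  + by move=> a v; rewrite -elr -phir; congr (el _ (phi _));
      apply: el_inj; rewrite elr !elVK.
  move=> g gP; have [f fP] := fullF _ _ g; exists f => x; apply: el_inj.
  by rewrite elM fP gP elK.
move=> M.
have r_lin : linear r.
  by move=> c a b; apply: el_inj; rewrite el_lin !elVK mact_linl.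
have rM a b : r (amul a b) = r b \om r a.
  by apply: el_inj; rewrite elr !elVK mactA.
have r1 : r (aone A) = lid G.
  by apply: el_inj; rewrite elVK mact1 /el fmap_id /= id_lfunE.
(* [r] reverses products and dualizing reverses them again, so this is a left action. *)
pose act a (w : dualV (lhom M G)) : dualV (lhom M G) := dual_post (r a) w.
have actA a b w : act (amul a b) w = act a (act b w).
  by apply/lfunP => g; rewrite !dual_postE rM lcompmA.
have act1 w : act (aone A) w = w.
  by apply/lfunP => g; rewrite dual_postE r1 lcomp1m.
have act_linl w : linear (fun a => act a w).
  move=> c a b; apply/lfunP => g; rewrite add_lfunE scale_lfunE !dual_postE.
  by rewrite r_lin lcomp_linl linearP.
have act_linr a : linear (act a).
  move=> c u v; apply/lfunP => g.
  by rewrite !(add_lfunE, scale_lfunE) !dual_postE add_lfunE scale_lfunE.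
pose W := FdMod actA act1 act_linl act_linr.
have [Z [j [j' [j'j jj']]]] := surjF W.
have jK : cancel (vsval j) (vsval j').
  move=> w; have := congr1 (fun f : mhom W W => vsval f w) j'j.
  by rewrite /= comp_lfunE id_lfunE.
have j'K : cancel (vsval j') (vsval j).
  move=> w; have := congr1 (fun f : mhom (F Z) (F Z) => vsval f w) jj'.
  by rewrite /= comp_lfunE id_lfunE.
exists Z, (fun w => elV Z (vsval j (w : W))); split.
- by move=> c u v; apply: el_inj; rewrite el_lin !elVK linearP.
- exists (fun z => vsval j' (el Z z)); first by move=> w; rewrite elVK jK.
  by move=> z; rewrite j'K elK.
move=> w s; have [a ->] := r_surj s; apply: el_inj.
by rewrite elr !elVK -mhomP.
Qed.

End GeneratorExists.

(** * The Nakayama-twisted trace *)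

Section Presentations.
Local Open Scope ring_scope.
Context {k : fieldType} {Mc : lcategory k} (cp : copowers Mc).
Context (G : Mc) (genG : is_generator G).

Local Notation cpu := (cpw_unit cp).

(* A functional separating y from the image of Hom(G, e) defines a morphism
   Y -> Z, with Z realizing Hom(G, G)^*, that kills e but not y. *)
Lemma generator_projective : projective G.
Proof.
move=> X Y e y epe.
have [/memv_imgP[x _ ->]|/negP y_im] := EM (is_true (y \in limg (postc G e))).
  by exists x; rewrite postcE.
have [l l0 ly] := separating_functional y_im.
have [Z [theta [theta_lin theta_bij theta_r]]] := generator_dual genG G.
pose w (y' : lhom G Y) : dualV (lhom G G) := (l \o postc G y')%VF.
have wE y' r : w y' r = l (y' \om r) by rewrite comp_lfunE postcE.
have [|y' r|f fP] := @generator_full _ _ _ genG Y Z (fun y' => theta (w y')).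
- move=> c u v; rewrite -theta_lin; congr theta; apply/lfunP => r.
  by rewrite !(add_lfunE, scale_lfunE) !wE lcomp_linl linearP.
- by rewrite -theta_r; congr theta; apply/lfunP => s;
    rewrite dual_postE !wE lcompmA.
have th0 : theta 0 = 0.
  by have := theta_lin (-1) 0 0; rewrite addr0 !scaleN1r oppr0 addNr.
have fe : f \om e = 0 \om e.
  apply: (generator_eq genG) => x; rewrite -!lcompmA -fP lcomp0f -th0.
  congr theta; apply/lfunP => r; rewrite wE zero_lfunE l0 //.
  by apply/memv_imgP; exists (x \om r); rewrite ?memvf // postcE lcompmA.
have wy : w y = 0.
  by apply: (bij_inj theta_bij); rewrite fP (epe _ _ _ fe) lcomp0f th0.
by case/eqP: ly; rewrite -[y]lcompm1 -wE wy zero_lfunE.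
Qed.

(** A linear section of Hom(P, e) on its image provides lifts depending linearly on the vector in
    [V]. *)
Lemma copower_projective (V : vectType k) (P : Mc) :
  projective P -> projective (cp V P).
Proof.
move=> prP X Y e f epe.
have surj y : y \in limg (postc P e).
  have [x <-] := prP _ _ e y epe.
  by rewrite -postcE memv_img // memvf.
have [|g gP] := @cpw_ext_fun _ _ cp V P X
    (fun v => ((postc P e)^-1)%VF (f \om cpu V P v)).
  by move=> c u v; rewrite linearP lcomp_linr linearP.
by exists g; apply: cpw_eq => v; rewrite -lcompmA gP -postcE limg_lfunVK.
Qed.

(** [p] is the evaluation from the copower of [G] by Hom(G, M), and [d] comes from the copower of
    [G] by the kernel of Hom(G, p). *)
Lemma projective_presentation (M : Mc) :
  exists (P1 P0 : proj Mc) (d : lhom P1 P0) (p : lhom P0 M), is_coker d p.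
Proof.
pose V : vectType k := lhom G M.
have [|p pP] := @cpw_ext_fun _ _ cp V G M (fun x => x); first by [].
pose K : vectType k := subvs_of (lker (postc G p)).
have [|d dP] := @cpw_ext_fun _ _ cp K G (cp V G) (fun x => vsval x).
  by move=> c x y; rewrite linearP.
have prG W := @copower_projective W _ generator_projective.
exists (Proj (prG K)), (Proj (prG V)), d, p; split.
  apply: (@cpw_eq _ _ cp) => x; rewrite lcomp0f -lcompmA dP -postcE.
  by apply/eqP; rewrite -memv_ker; exact: subvsP.
move=> L q qd.
have qp (y y' : lhom G (cp V G)) : p \om y = p \om y' -> q \om y = q \om y'.
  move=> pyy'; have yK : y - y' \in lker (postc G p).
    by rewrite memv_ker linearB /= !postcE pyy' subrr.
  have := dP (Subvs yK); rewrite /= => ydE.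
  apply/eqP; rewrite -subr_eq0 -!postcE -linearB /= postcE -ydE lcompmA qd.
  by rewrite lcomp0f.
(* [cpu V G x] lifts [x] along [p]; by [qp] the choice of lift does not affect the composite with
   [q], hence compatibility with endomorphisms of [G]. *)
have [||u uP] := @generator_full _ _ _ genG M L (fun x => q \om cpu V G x).
- by move=> c x y; rewrite linearP lcomp_linr.
- by move=> x r; rewrite -lcompmA; apply: qp; rewrite lcompmA !pP.
exists u; split=> [|u' u'p].
  apply: (generator_eq genG) => y; rewrite -lcompmA -uP; apply: qp; exact: pP.
by apply: (generator_eq genG) => x; rewrite -uP -u'p -lcompmA pP.
Qed.

(** Projectivity splits the evaluation from the copower of [G] by Hom(G, P); the [q i] are the
    coordinates of the splitting [s] in a basis of Hom(G, P). *)
Lemma dual_basis (P : Mc) : projective P ->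
  exists n (p : 'I_n -> lhom G P) (q : 'I_n -> lhom P G),
    \sum_(i < n) (p i \om q i) = lid P.
Proof.
move=> prP; pose V : vectType k := lhom G P.
have [|p pP] := @cpw_ext_fun _ _ cp V G P (fun x => x); first by [].
have p_epi : epi p.
  by move=> L g h gh; apply: (generator_eq genG) => x; rewrite -(pP x) !lcompmA gh.
have [s ps] := prP _ _ p (lid P) p_epi.
pose b := vbasis {:V}.
have q_ex i : exists q : lhom (cp V G) G,
    forall v, q \om cpu V G v = coord b i v *: lid G.
  by apply: cpw_ext_fun => c u v; rewrite linearP scalerDl scalerA.
pose q i := the 0 (fun q : lhom (cp V G) G =>
  forall v, q \om cpu V G v = coord b i v *: lid G).
have qP i v : q i \om cpu V G v = coord b i v *: lid G by apply: theP (q_ex i) v.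
exists _, (fun i => b`_i), (fun i => q i \om s); rewrite -ps.
under eq_bigr do rewrite lcompmA; rewrite -lcomp_suml; congr (_ \om s).
apply: (@cpw_eq _ _ cp) => v; rewrite pP lcomp_suml.
rewrite [RHS](coord_vbasis (memvf v)); apply: eq_bigr => i _.
by rewrite -lcompmA qP -postcE linearZ /= postcE lcompm1.
Qed.

End Presentations.

Section NakayamaTrace.
Local Open Scope ring_scope.
Context {k : fieldType} {Mc : lcategory k} {cp : copowers Mc}.
Context (N : nakayama cp) (G : Mc) (genG : is_generator G).

(** The object [Z] realizing Hom(M, G)^* is a model of the coend: [theta] induces [h] from [N M] to
    [Z], and [h'] is a left inverse of it. Under [h], the map [nak_in] at [G] becomes the bijection
    [theta]. *)
Lemma nak_in_bij (M : Mc) : bijective (@nak_in k Mc cp N M G).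
Proof.
have [Z [theta [theta_lin theta_bij theta_r]]] := generator_dual genG M.
have j_ex X (w : dualV (lhom M X)) :
    exists j : lhom X Z, forall x, theta (dual_post x w) = j \om x.
  apply: (generator_full genG) => [c x y|x r]; last first.
    rewrite -theta_r; congr theta; apply/lfunP => g.
    by rewrite !dual_postE lcompmA.
  rewrite -theta_lin; congr theta; apply/lfunP => g.
  by rewrite !(add_lfunE, scale_lfunE) !dual_postE lcomp_linl linearP.
pose j X (w : dualV (lhom M X)) :=
  the 0 (fun j : lhom X Z => forall x, theta (dual_post x w) = j \om x).
have jP X w x : theta (dual_post x w) = j X w \om x by apply: theP (j_ex X w) x.
have [||h hP] := @nak_desc _ _ _ N M Z j.
- move=> X c u v; apply: (generator_eq genG) => x; rewrite lcomp_linl -!jP -theta_lin.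
  by congr theta; apply/lfunP => g;
    rewrite !(dual_postE, add_lfunE, scale_lfunE).
- move=> X Y f w; apply: (generator_eq genG) => x; rewrite -lcompmA -!jP; congr theta.
  by apply/lfunP => g; rewrite !dual_postE lcompmA.
have hG w : h \om nak_in N w = theta w.
  rewrite hP -[j G w]lcompm1 -jP; congr theta.
  by apply/lfunP => g; rewrite dual_postE lcomp1m.
case: theta_bij => theta' thetaK theta'K.
have theta'_lin : linear theta'.
  by move=> c u v; apply: (can_inj thetaK); rewrite theta_lin !theta'K.
have [||h' h'P] := @generator_full _ _ _ genG Z (N M) (fun z => nak_in N (theta' z)).
- by move=> c u v; rewrite theta'_lin nak_in_linear.
- move=> z r; rewrite nak_in_comp; congr nak_in; apply: (can_inj thetaK).
  by rewrite theta_r !theta'K.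
have h'h : h' \om h = lid (N M).
  apply: (@nak_eq _ _ _ N) => X w; apply: (generator_eq genG) => x.
  by rewrite lcomp1m -!lcompmA nak_in_comp hG -h'P thetaK.
exists (fun y => theta' (h \om y)) => [w|y]; first by rewrite hG thetaK.
by rewrite h'P lcompmA h'h lcomp1m.
Qed.

Lemma nak_trace_in (P : proj Mc) X (w : dualV (lhom P X)) (f : lhom P X) :
  nak_trace N P (nak_in N w \om f) = w f.
Proof.
(* [nak_trace] is given by description, so its defining property follows once some functional has
   it. *)
suff [t tP] : exists t : dualV (lhom P (N P)),
    forall X (w : dualV (lhom P X)) (f : lhom P X), t (nak_in N w \om f) = w f.
  pose Q (t' : dualV (lhom P (N P))) :=
    forall X (w : dualV (lhom P X)) (f : lhom P X),
      t' (nak_i N X P \om cpw_tens cp w f) = w f.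
  have H : Q (nak_trace N P).
    apply: (@theP _ _ Q); exists t => X' w' f'.
    by rewrite -(tP X' w' f') nak_inE /cpw_tens lcompmA.
  by rewrite -(H X w f) nak_inE /cpw_tens lcompmA.
have [n [p [q pq]]] := dual_basis cp genG (@pobP _ _ P).
pose b := linfun (@nak_in k Mc cp N P G).
have bE v : b v = nak_in N v by rewrite /b linfunE //; exact: nak_in_linear.
have bK : cancel b b^-1%VF.
  apply: lfun_injK => u v; rewrite !bE; exact: (bij_inj (nak_in_bij P)).
(* A Hattori-Stallings type formula: for [y = nak_in w \om f] the i-th term is
   [w (f \om p i \om q i)], and the terms sum to [w f]. *)
pose t0 (y : lhom P (N P)) : k^o := \sum_(i < n) (b^-1%VF (y \om p i) : dualV _) (q i).
have t0_lin : linear t0.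
  move=> c u v; rewrite /t0 scaler_sumr -big_split /=; apply: eq_bigr => i _.
  by rewrite lcomp_linl linearP add_lfunE scale_lfunE.
exists (linfun t0) => X' w' f'; rewrite linfunE // /t0.
under eq_bigr do rewrite -lcompmA nak_in_comp -bE bK dual_postE -lcompmA.
by rewrite -linear_sum /= -lcomp_sumr pq lcompm1.
Qed.

(** Non-degeneracy: on a test map [x] from [G], the composite [f \om x] is [nak_in v] for a unique
    [v], and the traces recover all values of [v]. *)
Lemma nak_trace_eq (P : proj Mc) (M : Mc) (f f' : lhom M (N P)) :
  (forall g, nak_trace N P (f \om g) = nak_trace N P (f' \om g)) -> f = f'.
Proof.
move=> ff'; apply: (generator_eq genG) => x.
case: (nak_in_bij P) => b bK Kb.
rewrite -[f \om x]Kb -[f' \om x]Kb; congr nak_in; apply/lfunP => g.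
have := ff' (x \om g); rewrite !lcompmA -[f \om x]Kb -[f' \om x]Kb.
by rewrite !(nak_trace_in (P := P)) !Kb.
Qed.

Lemma nak_in_trace (P : proj Mc) :
  nak_in N (nak_trace N P) = lid (N P).
Proof. by apply: nak_trace_eq => g; rewrite nak_trace_in lcomp1m. Qed.

End NakayamaTrace.

(** * The action and the twisted module structure of the Nakayama functor *)

Section Action.
Local Open Scope ring_scope.
Context {k : fieldType} {C : rigid} {Mc : lcategory k} (R : rmodcat C Mc).
Implicit Types (M N L : Mc) (X Y : C).

Local Notation "M ◁ X" := (ract R M X) (at level 45, left associativity).
Local Notation "f ◁m u" := (actm R f u) (at level 45, left associativity).

Lemma idto_comp (D : category) (X Y Z : D) (e : X = Y) (e' : Y = Z) :
  idto e' \oc idto e = idto (etrans e e').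
Proof. by case: Z / e'; rewrite comp1m. Qed.

(** The other triangle identity, obtained by letting [ld_zag] act on [L]; the remaining steps merge
    the strictness identities. *)
Lemma unitX_counitX L Y :
  (counitX R L Y ◁m idm Y^∨) \om unitX R (L ◁ Y^∨) Y = lid (L ◁ Y^∨).
Proof.
have [eX [eY zag]] := ld_zag (ldual C) Y.
rewrite /counitX /unitX !actm_compl !lidto_act -(actm_id R L Y^∨) !actmA_conj.
set a := lid L ◁m (_ ⊗m idm Y^∨); set b := lid L ◁m (idm Y^∨ ⊗m _).
have ab : a \om lidto (congr1 (ract R L) (esym (tensA Y^∨ Y Y^∨))) \om b
    = lidto (congr1 (ract R L) (esym eY)) \om lidto (congr1 (ract R L) eX).
  rewrite -!act_idto -!actm_comp !lcomp1m; congr (actm _ _ _).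
  by rewrite -[in RHS](comp1m (idto eX)) -zag compmA idtoK comp1m.
rewrite !lcompmA.
do 8?[rewrite -(lcompmA _ (lidto _) (lidto _)) lidto_comp
     | rewrite lidto_comp].
rewrite (lidto_irr _ (congr1 (ract R L) (esym (tensA Y^∨ Y Y^∨)))).
rewrite -(lcompmA (lidto _) a) -(lcompmA (lidto _) _ b) ab actm_id.
by rewrite !lidto_comp (lidto_irr _ erefl).
Qed.

Lemma sharpK L L' Y (h : lhom L (L' ◁ Y^∨)) : flat (sharp h) = h.
Proof.
rewrite /sharp /flat actm_compl -lcompmA unitX_nat lcompmA unitX_counitX.
by rewrite lcomp1m.
Qed.

Lemma flat_natl L L' L'' Y (h : lhom (L ◁ Y) L') (f : lhom L' L'') :
  flat (f \om h) = (f ◁m idm Y^∨) \om flat h.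
Proof. by rewrite /flat actm_compl -lcompmA. Qed.

Lemma flat_inj L L' Y : injective (@flat k C Mc R L L' Y).
Proof. exact: can_inj (@flatK k C Mc R L L' Y). Qed.

Lemma flat_linear L L' Y : linear (@flat k C Mc R L L' Y).
Proof. by move=> c g h; rewrite /flat actm_lin lcomp_linl. Qed.

Lemma cl_flat M L X (f : lhom (M ◁ X) (L ◁ X^∨^∨)) :
  cl f = counitX R L X^∨ \om flat f.
Proof. by rewrite /cl -lcompmA. Qed.

Lemma cl_natl M L L' X (a : lhom L L') (f : lhom (M ◁ X) (L ◁ X^∨^∨)) :
  cl ((a ◁m idm X^∨^∨) \om f) = a \om cl f.
Proof. by rewrite !cl_flat flat_natl lcompmA counitX_nat -lcompmA. Qed.

Lemma cl_natr M M' L X (f : lhom (M ◁ X) (L ◁ X^∨^∨)) (b : lhom M' M) :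
  cl (f \om (b ◁m idm X)) = cl f \om b.
Proof. by rewrite !cl_flat flat_natr lcompmA. Qed.

(** This links the closing operator in the condition on traces to the transposes in the condition on
    transformations of Hom functors. *)
Lemma cl_comp_flat M L P X (h : lhom M (L ◁ X^∨^∨)) (g : lhom (P ◁ X) M) :
  cl (h \om g) = sharp h \om flat g.
Proof. by rewrite /cl /sharp /flat actm_compl !lcompmA. Qed.

Lemma ldm_id X : (idm X)^∨m = idm X^∨.
Proof.
have [eX [eY zag]] := ld_zag (ldual C) X.
rewrite /ldm tensm_id tensm_id compm1.
rewrite (idto_irr (tens1X _) eY); move: zag; rewrite !compmA => ->.
by rewrite comp1m idto_comp (idto_irr _ erefl).
Qed.

Section Copowers.
Context (cp : copowers Mc).
Local Notation cpu := (cpw_unit cp).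

(** Acting by [Y] is left adjoint to acting by its left dual, so it preserves copowers; [flat] moves
    the test to the copower itself. *)
Lemma act_cpw_eq (V : vectType k) M L Y (f g : lhom (cp V M ◁ Y) L) :
    (forall v, f \om (cpu V M v ◁m idm Y) = g \om (cpu V M v ◁m idm Y)) ->
  f = g.
Proof.
move=> fg; apply: flat_inj; apply: (@cpw_eq _ _ cp) => v.
by rewrite -!flat_natr fg.
Qed.

Lemma act_cpw_ext (V : vectType k) M L Y (g : V -> lhom (M ◁ Y) L) :
    linear g ->
  exists f : lhom (cp V M ◁ Y) L, forall v, f \om (cpu V M v ◁m idm Y) = g v.
Proof.
move=> lg; have [|f fP] := @cpw_ext_fun _ _ cp V M _ (fun v => flat (g v)).
  by move=> c u v; rewrite lg flat_linear.
by exists (sharp f) => v; apply: flat_inj; rewrite flat_natr sharpK fP.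
Qed.

Lemma cpw_canE (V : vectType k) M Y v :
  cpw_can cp (actf R Y) V M \om (cpu V M v ◁m idm Y) = cpu V (M ◁ Y) v.
Proof.
rewrite /cpw_can; set e := cpw_ext _ _.
have eE u : e \om cpu V (M ◁ Y) u = cpu V M u ◁m idm Y.
  by rewrite cpw_extE comp_lfunE /= actf_mapE.
(* [linv e] is an inverse only once one is known to exist; it is obtained by extending the units of
   the target copower. *)
have e_iso : is_iso e.
  have [|e' e'P] := @act_cpw_ext V M (cp V (M ◁ Y)) Y (cpu V (M ◁ Y)).
    by move=> c u w; rewrite linearP.
  exists e'; split; first by apply: (@cpw_eq _ _ cp) => u;
    rewrite -lcompmA eE e'P lcomp1m.
  by apply: act_cpw_eq => u; rewrite -lcompmA e'P eE lcomp1m.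
have [e'e _] := linvP e_iso.
by rewrite -eE lcompmA e'e lcomp1m.
Qed.

Context (N : nakayama cp).

Definition dual_cl M L X (w : dualV (lhom M L)) :
  dualV (lhom (M ◁ X) (L ◁ X^∨^∨)) := dualmap (clmap R M L X) w.

Lemma dual_clE M L X (w : dualV (lhom M L)) f :
  dual_cl X w f = w (cl f).
Proof. by rewrite /dual_cl dualmapE clmapE. Qed.

Lemma act_nak_eq M L Y (f g : lhom (N M ◁ Y) L) :
    (forall L' (w : dualV (lhom M L')),
      f \om (nak_in N w ◁m idm Y) = g \om (nak_in N w ◁m idm Y)) ->
  f = g.
Proof.
move=> fg; apply: flat_inj; apply: (@nak_eq _ _ _ N) => L' w.
by rewrite -!flat_natr fg.
Qed.

Lemma nak_PsiE M X L (w : dualV (lhom M L)) :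
  nak_Psi R N M X \om (nak_in N w ◁m idm X^∨^∨) = nak_in N (dual_cl X w).
Proof.
pose Q psi := forall L : Mc,
  psi \om (nak_i N L M ◁m idm X^∨^∨)
    = nak_i N (L ◁ X^∨^∨) (M ◁ X)
        \om cpw_map cp (dualmap (clmap R M L X)) (lid (L ◁ X^∨^∨))
        \om cpw_can cp (actf R X^∨^∨) (dualV (lhom M L)) L.
have rhsE L' (w' : dualV (lhom M L')) :
    nak_i N (L' ◁ X^∨^∨) (M ◁ X)
        \om cpw_map cp (dualmap (clmap R M L' X)) (lid (L' ◁ X^∨^∨))
        \om cpw_can cp (actf R X^∨^∨) (dualV (lhom M L')) L'
        \om (cpu _ L' w' ◁m idm X^∨^∨) = nak_in N (dual_cl X w').
  by rewrite -!lcompmA cpw_canE cpw_mapE lcompm1 -nak_inE.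
suff QP : Q (nak_Psi R N M X).
  by rewrite nak_inE actm_compl lcompmA QP rhsE.
apply: (@theP _ _ Q).
(* The coend describes maps out of [N M] only, so the required map out of [N M ◁ X^∨^∨] is built as
   its transpose. *)
have [||h hP] := @nak_desc _ _ _ N M (N (M ◁ X) ◁ X^∨^∨^∨)
    (fun L' w' => flat (nak_in N (dual_cl X w'))).
- move=> L' c u v; rewrite -flat_linear -nak_in_linear; congr (flat (nak_in _ _)).
  by apply/lfunP => g; rewrite !(dual_clE, add_lfunE, scale_lfunE).
- move=> L1 L2 f w'; rewrite -flat_natr nak_in_comp; congr (flat (nak_in _ _)).
  by apply/lfunP => g; rewrite !(dual_clE, dual_postE) cl_natl.
exists (sharp h) => L'; apply: act_cpw_eq => w'; rewrite rhsE.
apply: flat_inj; rewrite -hP -[X in flat X]lcompmA -actm_compl -nak_inE.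
by rewrite flat_natr sharpK.
Qed.

Lemma nak_Psi_nat M M' X (f : lhom M M') :
  nak_Psi R N M' X \om (fmap N M M' f ◁m idm X^∨^∨)
    = fmap N _ _ (f ◁m idm X) \om nak_Psi R N M X.
Proof.
apply: act_nak_eq => L w; rewrite -!lcompmA -actm_compl nak_in_fmap !nak_PsiE.
rewrite nak_in_fmap; congr nak_in; apply/lfunP => g.
by rewrite !(dual_clE, dual_preE) cl_natr.
Qed.

End Copowers.
End Action.

(** * The three bijections *)

Section Extension.
Local Open Scope ring_scope.
Context {k : fieldType} {Mc : lcategory k} (cp : copowers Mc).
Context (G : Mc) (genG : is_generator G).
Context (S T : lfunctor Mc Mc) (S_exact : right_exact S).

Lemma right_exact_presentation (M : Mc) :
  exists (P1 P0 : proj Mc) (d : lhom P1 P0) (p : lhom P0 M),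
  [/\ epi p, p \om d = 0 & is_coker (fmap S _ _ d) (fmap S _ _ p)].
Proof.
have [P1 [P0 [d [p dp]]]] := projective_presentation cp genG M.
exists P1, P0, d, p; split; [exact: coker_epi dp | by case: dp |].
exact: S_exact.
Qed.

Lemma natural_eq_on_proj (xi xi' : natfam S T) :
  natural xi -> natural xi' -> (forall P : proj Mc, xi P = xi' P) -> xi = xi'.
Proof.
move=> nxi nxi' xiP; apply: functional_extensionality_dep => M.
have [P1 [P0 [d [p [_ _ /coker_epi]]]]] := right_exact_presentation M.
by apply; rewrite nxi nxi' xiP.
Qed.

Lemma natural_extend_from_proj (x : forall P : proj Mc, lhom (S P) (T P)) :
    (forall (P Q : proj Mc) (f : lhom P Q),
      x Q \om fmap S _ _ f = fmap T _ _ f \om x P) ->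
  exists2 xi : natfam S T, natural xi & forall P : proj Mc, xi P = x P.
Proof.
move=> nx.
(* Compatibility is demanded for every map from a projective, so that naturality does not depend on
   the chosen presentation. *)
pose H M (h : lhom (S M) (T M)) := forall (P : proj Mc) (p : lhom P M),
  h \om fmap S _ _ p = fmap T _ _ p \om x P.
have H_ex M : exists h, H M h.
  have [P1 [P0 [d [p [p_epi pd [_ cokS]]]]]] := right_exact_presentation M.
  have [|h [hP _]] := cokS _ (fmap T _ _ p \om x P0).
    by rewrite -lcompmA nx lcompmA -fmap_comp pd linear0 lcomp0f.
  exists h => P q; have [a <-] := @pobP _ _ P _ _ p q p_epi.
  by rewrite !fmap_comp lcompmA hP -!lcompmA nx.
pose xi M := the 0 (H M).
have xiP M : H M (xi M) by apply: (@theP _ _ (H M)).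
exists xi => [M M' f|P].
  have [P1 [P0 [d [p [_ _ /coker_epi Sp_epi]]]]] := right_exact_presentation M.
  apply: Sp_epi; rewrite -!lcompmA -fmap_comp xiP.
  by rewrite xiP fmap_comp lcompmA.
by have := xiP P P (lid P); rewrite !fmap_id lcompm1 lcomp1m.
Qed.

End Extension.

Section Bijections.
Local Open Scope ring_scope.
Context {k : fieldType} {Mc : lcategory k} (cp : copowers Mc).
Context (N : nakayama cp) (G : Mc) (genG : is_generator G).
Context (S : lfunctor Mc Mc) (S_exact : right_exact S).

Lemma Phi1E (xi : natfam S N) (P : proj Mc) f :
  Phi1 xi P f = nak_trace N P (xi P \om f).
Proof. by rewrite comp_lfunE postcE. Qed.

Lemma nak_trace_is_trace : is_trace (nak_trace N).
Proof.
move=> P Q f y.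
have [w ->] : exists w, y = nak_in N w.
  (* This functional is [g |-> nak_trace N P (y \om g)]; with it, both sides of the trace identity
     become [w f]. *)
  exists (dual_post y (nak_trace N P)).
  by rewrite -nak_in_comp (nak_in_trace N genG) lcomp1m.
rewrite nak_in_fmap -[nak_in N (dual_pre f w)]lcompm1.
rewrite (nak_trace_in N genG) (nak_trace_in N genG (P := Q)).
by rewrite dual_preE lcomp1m.
Qed.

Lemma Phi1_trace (xi : natfam S N) : natural xi -> is_trace (Phi1 xi).
Proof.
move=> nxi P Q f g.
by rewrite !Phi1E !lcompmA nak_trace_is_trace nxi lcompmA.
Qed.

Lemma Phi1_inj (xi xi' : natfam S N) :
  natural xi -> natural xi' -> Phi1 xi = Phi1 xi' -> xi = xi'.
Proof.
move=> nxi nxi' xixi'; apply: (natural_eq_on_proj cp genG S_exact) => // P.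
by apply: (nak_trace_eq genG) => f; rewrite -!Phi1E xixi'.
Qed.

Lemma Phi1_surj (t : trfam S) :
  is_trace t -> exists2 xi : natfam S N, natural xi & Phi1 xi = t.
Proof.
move=> tr.
(* The trace identity for [t] is exactly naturality of [nak_in N (t P)] in [P]. *)
have [|xi nxi xiP] := @natural_extend_from_proj _ _ cp _ genG S N S_exact
    (fun P => nak_in N (t P)).
  move=> P Q f; rewrite nak_in_comp nak_in_fmap; congr nak_in; apply/lfunP => g.
  by rewrite dual_postE dual_preE tr.
exists xi => //; apply: functional_extensionality_dep => P; apply/lfunP => f.
by rewrite Phi1E xiP (nak_trace_in N genG).
Qed.

Lemma Phi2_nat (t : trfam S) : is_trace t -> is_nat_h (Phi2 t).
Proof.
move=> tr M M' P Q a b f g; rewrite !Phi2E -!lcompmA -tr.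
by rewrite !lcompmA.
Qed.

Lemma Phi2_inj : injective (@Phi2 k Mc S).
Proof.
move=> t t' tt'; apply: functional_extensionality_dep => P; apply/lfunP => f.
by have := Phi2E t f (lid P); rewrite tt' Phi2E lcompm1.
Qed.

Lemma Phi2_surj (al : hfam S) :
  is_nat_h al -> exists2 t, is_trace t & Phi2 t = al.
Proof.
move=> nal.
(* As in the Yoneda lemma, [al] is recovered from its values at identities. *)
pose t0 (P : proj Mc) (f : lhom P (S P)) : k^o := al P P f (lid P).
have t0_lin P : linear (@t0 P).
  by move=> c f g; rewrite /t0 linearP add_lfunE scale_lfunE.
pose t : trfam S := fun P => linfun (@t0 P).
have tE (P : proj Mc) f : t P f = al P P f (lid P) by rewrite /t linfunE.
exists t => [P Q f g|].
  (* Naturality in either variable brings the two sides to [al Q P g f]. *)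
  rewrite !tE.
  have := nal _ _ P P f (lid P) g (lid P).
  rewrite fmap_id lcomp1m !lcompm1 => ->.
  have := nal _ _ P Q (lid Q) f g (lid Q).
  by rewrite !lcompm1 lcomp1m => ->.
apply: functional_extensionality_dep => M.
apply: functional_extensionality_dep => P; apply/lfunP => f; apply/lfunP => g.
rewrite Phi2E tE; have := nal _ _ P P g (lid P) f (lid P).
by rewrite fmap_id lcomp1m !lcompm1.
Qed.

(** [Phi2 (Phi1 xi)] is [nak_alpha] after postcomposition with [xi], so [xi] meets the description
    defining [Phi3]. Bijectivity of [Phi3] is deduced from this identity. *)
Lemma Phi3_Phi2_Phi1 (xi : natfam S N) :
  natural xi -> Phi3 N (Phi2 (Phi1 xi)) = xi.
Proof.
move=> nxi.
pose Q (xi' : natfam S N) := natural xi' /\ forall (M : Mc) (P : proj Mc),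
  ((nak_alpha N M P)^-1 \o Phi2 (Phi1 xi) M P)%VF = postc M (xi' P).
have Qxi : Q xi.
  split=> // M P; apply/lfunP => f; rewrite comp_lfunE postcE.
  have -> : Phi2 (Phi1 xi) M P f = nak_alpha N M P (xi P \om f).
    by apply/lfunP => g; rewrite !Phi2E Phi1E lcompmA.
  (* Non-degeneracy makes [nak_alpha] injective, so its linear pseudo-inverse is a left inverse. *)
  apply: lfun_injK => u v uv; apply: (nak_trace_eq genG) => g.
  by rewrite -!Phi2E -/(nak_alpha N) uv.
have [nxi' xi'P] : Q (Phi3 N (Phi2 (Phi1 xi))).
  by apply: (@theP _ _ Q); exists xi.
apply: (natural_eq_on_proj cp genG S_exact) => // P.
have := congr1 (fun F : 'Hom(_, _) => F (lid (S P))) (xi'P (S P) P).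
by rewrite Qxi.2 !postcE !lcompm1.
Qed.

End Bijections.

(** * Transport of module-compatibility *)

Section Compatibility.
Local Open Scope ring_scope.
Context {k : fieldType} {C : rigid} {Mc : lcategory k} (R : rmodcat C Mc).
Context (cp : copowers Mc) (N : nakayama cp) (S : rexfun R).
Context (G : Mc) (genG : is_generator G).

Local Notation "M ◁ X" := (ract R M X) (at level 45, left associativity).
Local Notation "f ◁m u" := (actm R f u) (at level 45, left associativity).

(* At a projective P the identity of N P is [nak_in] of the trace, so [nak_PsiE]
   computes Psi itself. *)
Lemma nak_trace_compatible (P : proj Mc) (X : C)
    (f : lhom (P ◁ X) (N P ◁ X^∨^∨)) :
  nak_trace N P (cl f) = nak_trace N (actP R P X) (nak_Psi R N P X \om f).
Proof.
have -> : nak_Psi R N P X = nak_in N (dual_cl R X (nak_trace N P)).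
  by rewrite -nak_PsiE (nak_in_trace N genG) actm_id lcompm1.
by rewrite (nak_trace_in N genG (P := actP R P X)) dual_clE.
Qed.

(** Naturality of [cl] moves [xi] inside the closing operator, where compatibility of [nak_trace]
    applies. Conversely, non-degeneracy gives the equation at projectives, and it descends along a
    projective cover map [p] of [M]. *)
Lemma Phi1_compatible (xi : natfam S N) : natural xi ->
  compatible_nat xi <-> compatible_trace (Phi1 xi).
Proof.
move=> nxi; split=> [cxi P X f|ctr].
  rewrite !Phi1E -cl_natl nak_trace_compatible !lcompmA.
  by rewrite -[xi (actP R P X)]/(xi (P ◁ X)) cxi.
have cP (P : proj Mc) X :
    xi (P ◁ X) \om Psi S P X = nak_Psi R N P X \om (xi P ◁m idm X^∨^∨).
  apply: (nak_trace_eq genG (P := actP R P X)) => f.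
  have := ctr P X f; rewrite !Phi1E -cl_natl nak_trace_compatible !lcompmA.
  by move=> ->.
move=> M X.
have [P1 [P0 [d [p [_ _ /coker_epi Sp]]]]] :=
  right_exact_presentation cp genG (rexf_exact S) M.
(* Acting by the double dual preserves epimorphisms, since that object is itself a left dual. *)
apply: (act_epi (X := X^∨) Sp).
rewrite -!lcompmA -actm_compl nxi actm_compl.
rewrite (lcompmA (nak_Psi R N M X)) nak_Psi_nat -[RHS]lcompmA -cP.
have := Psi_nat S p (idm X); rewrite !ldm_id => ->.
by rewrite !lcompmA nxi.
Qed.

(** By [cl_comp_flat], the condition on [Phi2 t] is the condition on [t] for maps of the form
    [flat f \om g]. *)
Lemma Phi2_compatible (t : trfam S) :
  compatible_trace t <-> compatible_nat_h (Phi2 t).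
Proof.
split=> [ct M P X f g|ch P X f].
  by rewrite !Phi2E -lcompmA -ct cl_comp_flat flatK.
(* Taking [S P ◁ X^∨^∨] for [M] and the transpose of its identity makes [flat] of the first argument
   trivial, so every [f] is reached. *)
have := ch _ P X (sharp (lid _)) f; rewrite !Phi2E sharpK lcompm1 => ->.
by rewrite -cl_comp_flat lcomp1m.
Qed.

End Compatibility.

Theorem theorem5p8 (k : fieldType) (C : rigid) (Mc : lcategory k)
    (R : rmodcat C Mc) (Mc_finab : finite_abelian Mc)
    (cp : copowers Mc) (N : nakayama cp) (S : rexfun R) :
  [/\ restricts_to_bijection
        (fun xi : natfam S N => natural xi /\ compatible_nat xi)
        (fun t : trfam S => is_trace t /\ compatible_trace t)
        (@Phi1 k Mc cp N S),
      restricts_to_bijection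
        (fun t : trfam S => is_trace t /\ compatible_trace t)
        (fun al : hfam S => is_nat_h al /\ compatible_nat_h al)
        (@Phi2 k Mc S)
    & restricts_to_bijection
        (fun al : hfam S => is_nat_h al /\ compatible_nat_h al)
        (fun xi : natfam S N => natural xi /\ compatible_nat xi)
        (@Phi3 k Mc cp N S)].
Proof.
have [G genG] := finite_abelian_generator Mc_finab.
have Sex := @rexf_exact _ _ _ _ S.
have bij1 : restricts_to_bijection
    (fun xi : natfam S N => natural xi /\ compatible_nat xi)
    (fun t : trfam S => is_trace t /\ compatible_trace t) (@Phi1 k Mc cp N S).
  split=> [xi [nxi cxi]|xi xi' [nxi _] [nxi' _]|t [tr ct]].
  - split; [exact: (Phi1_trace genG) | exact/(Phi1_compatible genG)].
  - exact: (Phi1_inj genG Sex).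
  - have [xi nxi xiE] := Phi1_surj N genG Sex tr.
    by exists xi => //; split=> //; apply/(Phi1_compatible genG) => //; rewrite xiE.
have bij2 : restricts_to_bijection
    (fun t : trfam S => is_trace t /\ compatible_trace t)
    (fun al : hfam S => is_nat_h al /\ compatible_nat_h al) (@Phi2 k Mc S).
  split=> [t [tr ct]|t t' _ _|al [nal cal]].
  - by split; [exact: Phi2_nat | exact/Phi2_compatible].
  - exact: Phi2_inj.
  - have [t tr tE] := Phi2_surj nal.
    by exists t => //; split=> //; apply/Phi2_compatible; rewrite tE.
split=> //; case: bij1 bij2 => [_ _ surj1] [_ _ surj2].
(* Every compatible [al] comes from a compatible [xi], so the claims on [Phi3] reduce to its being a
   left inverse of [Phi2] after [Phi1]. *)
have surj al : is_nat_h al /\ compatible_nat_h al -> exists2 xi : natfam S N,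
    natural xi /\ compatible_nat xi & Phi2 (Phi1 xi) = al.
  move=> /surj2[t /surj1[xi xiP <-] <-]; by exists xi.
have Phi3K (xi : natfam S N) : natural xi -> Phi3 N (Phi2 (Phi1 xi)) = xi.
  exact: (Phi3_Phi2_Phi1 genG Sex).
split=> [_ /surj[xi xiP <-]|_ _ /surj[xi [nxi _] <-] /surj[xi' [nxi' _] <-]|].
- by rewrite Phi3K //; case: xiP.
- by rewrite !Phi3K // => ->.
move=> xi [nxi cxi]; exists (Phi2 (Phi1 xi)); last exact: Phi3K.
split; first by apply: Phi2_nat; apply: (Phi1_trace genG).
by apply/Phi2_compatible/(Phi1_compatible genG).
Qed.
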